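(* Let $X$ be a manifold with an almost $s$-Kähler structure of rank two, $s\ge 2$. The Lie algebra bundle $\mathbf{u}\mathcal{L}^s$ is the full real Lie subalgebra bundle of $\mathcal{L}^s_{\mathbb{C}}$ of operators which preserve the form $\langle\ ,\ \rangle$, and its fibre is isomorphic to $\mathbf{su}(s+1,s+1)$.
   Context: Fix $s\ge 2$. An almost $s$-Kähler structure of rank two on a smooth manifold $X$ of dimension $2(s+1)$ consists of a Riemannian metric $\mathbf{g}$ and smooth two-forms $\omega_{jk}$, $j,k\in\{0,\dots,s\}$, such that: (i) $\omega_{01},\dots,\omega_{0s}$ are closed and around every point there are coordinates $x_1,x_2,y^j_1,y^j_2$ ($1\le j\le s$) with $\omega_{0j}=\sum_{i=1}^2 dx_i\wedge dy^j_i$ for all $j$; (ii) at every $p\in X$ there is an orthonormal basis $\{v_{ij}: i=1,2,\ j=0,\dots,s\}$ of $T^*_pX$ (an adapted coframe) with $\omega_{jk}=\sum_{i=1}^2 v_{ij}\wedge v_{ik}$ at $p$ for all $j,k$. Any two adapted coframes at $p$ are related by $v'_{ij}=\sum_l a_{il}v_{lj}$ with $(a_{il})\in \mathbf{O}(2)$; so the spaces $W_j=\langle v_{1j},v_{2j}\rangle$ are canonical. Choosing an orientation of $W_0$ at $p$ and using adapted coframes with $v_{10},v_{20}$ positively oriented determines the derivation $J$ of $\bigwedge^*T_p^*X$ with $J(v_{1j})=v_{2j}$, $J(v_{2j})=-v_{1j}$ (a determination of $J$), and the volume form $\Omega=v_{10}\wedge v_{20}\wedge\dots\wedge v_{1s}\wedge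 v_{2s}$. On $\bigwedge^*_{\mathbb{C}}T^*_pX$ let $E_{ij}$ be the wedge product with $v_{ij}$; $*$ denotes the adjoint with respect to the Hermitian metric $(\ ,\ )_p$ induced by $\mathbf{g}$. Put, for $j\neq k$, $L_{jk}=\sum_{i=1}^2E_{ij}E_{ik}$ (wedge with $\omega_{jk}$), $V_j=E_{1j}E_{2j}$ (wedge with the volume form of $W_j$), $\Lambda_{jk}=L_{jk}^*$, $A_j=V_j^*$. All Lie algebras have the commutator bracket. $\mathcal{L}^s_{\mathbb{R}}$ is the bundle of real Lie algebras with fibre at $p$ generated by all $L_{jk},V_j,\Lambda_{jk},A_j$ in $\mathrm{End}_{\mathbb{R}}(\bigwedge^*T_p^*X)$; $\mathcal{L}^s_{\mathbb{C}}=\mathcal{L}^s_{\mathbb{R}}\otimes_{\mathbb{R}}\mathbb{C}$ acts on $\bigwedge^*_{\mathbb{C}}T_p^*X$; $\mathbf{u}\mathcal{L}^s\subset\mathcal{L}^s_{\mathbb{C}}$ is the bundle of real Lie algebras with fibre generated over $\mathbb{R}$ by all $\sqrt{-1}L_{jk},\sqrt{-1}V_j,\sqrt{-1}\Lambda_{jk},\sqrt{-1}A_j$. The non-degenerate Hermitian inner product $\langle\ ,\ \rangle_p$ on $\bigwedge^*_{\mathbb{C}}T_p^*X$ is defined on homogeneous forms by $\langle\alpha,\beta\rangle_p=(\sqrt{-1})^{\deg(\alpha)\deg(\beta)}(\alpha\wedge\overline{\beta},\Omega)_p$. An operator $\phi$ preserves the form (in the infinitesimal sense) if $\langle\phi(\alpha),\beta\rangle_p+\langle\alpha,\phi(\beta)\rangle_p=0$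 for all $\alpha,\beta$. *)

(* Defs.v *)
From HB Require Import structures.
From mathcomp Require Import all_boot all_order all_algebra.
From mathcomp Require Import complex.
From mathcomp Require Import all_classical all_reals all_analysis.

Set Implicit Arguments.
Unset Strict Implicit.
Unset Printing Implicit Defensive.

Import Order.TTheory GRing.Theory Num.Theory.
Import numFieldNormedType.Exports.

Local Open Scope classical_set_scope.
Local Open Scope ring_scope.

(** * Smooth manifolds *)

(** [U] is meant to be open. *)
Fixpoint Ck_on (R : realType) (n k : nat) (U : set 'rV[R]_n)
    (f : 'rV[R]_n -> R) : Prop :=
  match k with
  | 0 => forall x, U x -> {for x, continuous f}
  | k'.+1 => [/\ forall x, U x -> {for x, continuous f},
      forall (i : 'I_n) x, U x -> derivable f x (delta_mx 0 i)
    & forall i : 'I_n, Ck_on k' U (fun x => 'D_(delta_mx 0 i) f x)]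
  end.

Definition smooth_on (R : realType) (n : nat) (U : set 'rV[R]_n)
    (f : 'rV[R]_n -> R) : Prop := forall k, Ck_on k U f.

(** The values of [cmap] off [cdom], and of [cinv] off the image of [cdom],
    are irrelevant. *)
Record chart (R : realType) (n : nat) (X : topologicalType) := Chart {
  cdom : set X;
  cmap : X -> 'rV[R]_n;
  cinv : 'rV[R]_n -> X
}.

Definition is_chart (R : realType) (n : nat) (X : topologicalType)
    (c : chart R n X) : Prop :=
  [/\ open (cdom c), open (cmap c @` cdom c),
      forall p, cdom c p -> cinv c (cmap c p) = p,
      forall p, cdom c p -> {for p, continuous (cmap c)}
    & forall x, (cmap c @` cdom c) x -> {for x, continuous (cinv c)}].

Definition transition (R : realType) (n : nat) (X : topologicalType)
    (c c' : chart R n X) : 'rV[R]_n -> 'rV[R]_n := cmap c' \o cinv c.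

Definition smooth_transition (R : realType) (n : nat) (X : topologicalType)
    (c c' : chart R n X) : Prop :=
  forall b : 'I_n, smooth_on (cmap c @` (cdom c `&` cdom c'))
                             (fun x => transition c c' x 0 b).

Record smooth_manifold (R : realType) (n : nat) := SmoothManifold {
  points :> topologicalType;
  atlas : set (chart R n points);
  manifold_hausdorff : hausdorff_space points;
  manifold_second_countable : @second_countable points;
  atlas_chart : forall c, atlas c -> is_chart c;
  atlas_cover : forall p, exists2 c, atlas c & cdom c p;
  atlas_smooth : forall c c', atlas c -> atlas c' -> smooth_transition c c';
  atlas_maximal : forall c, is_chart c ->
    (forall c', atlas c' -> smooth_transition c c' /\ smooth_transition c' c) ->
    atlas c
}.

(** ** Covariant 2-tensors

    [t c p] is the matrix of the components [t_p(d/dx_a, d/dx_b)] in the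
    coordinates [x_1, ..., x_n] of the chart [c]; its value is [u *m t c p *m w^T]
    on the tangent vectors with component rows [u] and [w].  With row vectors,
    the differential of a change of coordinates sends [u] to [u *m 'J]. *)

Definition tensor2 (R : realType) (n : nat) (X : smooth_manifold R n) : Type :=
  chart R n X -> X -> 'M[R]_n.

Definition is_smooth_tensor2 (R : realType) (n : nat) (X : smooth_manifold R n)
    (t : tensor2 X) : Prop :=
  (forall c c' p, atlas c -> atlas c' -> cdom c p -> cdom c' p ->
     t c p = ('J (transition c c') (cmap c p)) *m t c' p
             *m ('J (transition c c') (cmap c p))^T) /\
  (forall c (a b : 'I_n), atlas c ->
     smooth_on (cmap c @` cdom c) (fun x => t c (cinv c x) a b)).

Definition is_riemannian_metric (R : realType) (n : nat)
    (X : smooth_manifold R n) (g : tensor2 X) : Prop :=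
  is_smooth_tensor2 g /\
  (forall c p, atlas c -> cdom c p ->
     (g c p)^T = g c p /\
     forall u : 'rV[R]_n, u != 0 -> 0 < (u *m g c p *m u^T) 0 0).

Definition is_two_form (R : realType) (n : nat) (X : smooth_manifold R n)
    (w : tensor2 X) : Prop :=
  is_smooth_tensor2 w /\
  (forall c p, atlas c -> cdom c p -> (w c p)^T = - w c p).

(** [d w = 0], i.e. [d_a w_bc + d_b w_ca + d_c w_ab = 0] in coordinates. *)
Definition closed_two_form (R : realType) (n : nat) (X : smooth_manifold R n)
    (w : tensor2 X) : Prop :=
  forall ch, atlas ch ->
  let dw (a b c : 'I_n) (x : 'rV[R]_n) :=
    'D_(delta_mx 0 a) (fun y => w ch (cinv ch y) b c) x in
  forall (a b c : 'I_n) x, (cmap ch @` cdom ch) x ->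
    dw a b c x + dw b c a x + dw c a b x = 0.

(** Covectors are rows of components in the basis [dx_1, ..., dx_n]; this is
    the component matrix of the 2-form [u /\ w]. *)
Definition covector_wedge (R : realType) (n : nat) (u w : 'rV[R]_n) : 'M[R]_n :=
  u^T *m w - w^T *m u.

(** * Almost s-Kaehler structures of rank two *)

(** Families of [2 (s + 1)] covectors, indexed by [i] in {1,2} (here ['I_2])
    and [j] in {0, ..., s}. *)
Definition coframe (R : realType) (s : nat) : Type :=
  'I_2 -> 'I_s.+1 -> 'rV[R]_(2 * s.+1).

(** The inverse of the matrix of the metric is the Gram matrix of
    [dx_1, ..., dx_n].  Since [n = 2 (s + 1)], orthonormality makes [v] a basis. *)
Definition adapted_coframe (R : realType) (s : nat)
    (X : smooth_manifold R (2 * s.+1)) (g : tensor2 X)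
    (omega : 'I_s.+1 -> 'I_s.+1 -> tensor2 X)
    (c : chart R (2 * s.+1) X) (p : X) (v : coframe R s) : Prop :=
  (forall i j i' j',
     (v i j *m invmx (g c p) *m (v i' j')^T) 0 0
     = ((i == i') && (j == j'))%:R) /\
  (forall j k, omega j k c p = \sum_(i < 2) covector_wedge (v i j) (v i k)).

(** In [darboux], the coordinate of index [mxvec_index i j] is [x_i] if [j = 0]
    and [y^j_i] otherwise. *)
Record almost_sKahler (R : realType) (s : nat)
    (X : smooth_manifold R (2 * s.+1)) := AlmostSKahler {
  metric : tensor2 X;
  omega : 'I_s.+1 -> 'I_s.+1 -> tensor2 X;
  metric_riemannian : is_riemannian_metric metric;
  omega_two_form : forall j k, is_two_form (omega j k);
  omega_closed : forall j, j != ord0 -> closed_two_form (omega ord0 j);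
  darboux : forall p : X, exists c, [/\ atlas c, cdom c p &
    forall q j, cdom c q -> j != ord0 ->
      omega ord0 j c q =
      \sum_(i < 2) covector_wedge (delta_mx 0 (mxvec_index i ord0))
                                  (delta_mx 0 (mxvec_index i j))];
  adapted : forall c p, atlas c -> cdom c p ->
    exists v, adapted_coframe metric omega c p v
}.

(** * The complexified exterior algebra *)

(** [alpha : ext R n] is the form [\sum_I alpha I dx_I], where [dx_I] is the
    wedge product of the [dx_a], [a] in [I], in increasing order. *)
Notation ext R n := {ffun {set 'I_n} -> R[i]^o}.

(** The sign of [dx_I /\ dx_J] for disjoint [I] and [J]. *)
Definition wedge_sign (R : realType) (n : nat) (I J : {set 'I_n}) : R[i] :=
  (-1) ^+ #|[set ab : 'I_n * 'I_n | [&& ab.1 \in I, ab.2 \in J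
                                      & (ab.2 < ab.1)%N]]%SET|.

Definition wedge (R : realType) (n : nat) (alpha beta : ext R n) : ext R n :=
  [ffun K : {set 'I_n} => \sum_(I : {set 'I_n} | I \subset K)
     wedge_sign R I (K :\: I) * (alpha I : R[i]) * (beta (K :\: I) : R[i])].

Lemma wedge_is_linear (R : realType) (n : nat) (alpha : ext R n) :
  linear (wedge alpha : ext R n -> ext R n).
Proof.
move=> a x y; apply/ffunP => K; rewrite !ffunE scaler_sumr -big_split /=.
apply: eq_bigr => I _; rewrite !ffunE mulrDr; congr (_ + _).
by rewrite -[a *: _]/(a * _) mulrCA.
Qed.

HB.instance Definition _ (R : realType) (n : nat) (alpha : ext R n) :=
  GRing.isLinear.Build R[i] (ext R n) (ext R n) *:%R (wedge alpha)
    (wedge_is_linear alpha).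

Definition ext1 (R : realType) (n : nat) : ext R n :=
  [ffun I : {set 'I_n} => (I == finset.set0)%:R].

Definition one_form (R : realType) (n : nat) (u : 'rV[R]_n) : ext R n :=
  [ffun I : {set 'I_n} =>
     \sum_(a < n) (if I == [set a]%SET then (u 0 a)%:C%C else 0)].

Definition ext_conj (R : realType) (n : nat) (alpha : ext R n) : ext R n :=
  [ffun I : {set 'I_n} => (alpha I : R[i])^*].

Definition homog (R : realType) (n d : nat) (alpha : ext R n) : ext R n :=
  [ffun I : {set 'I_n} => if #|I| == d then alpha I else 0].

(** [G] is the Gram matrix of [dx_1, ..., dx_n]; for [#|I| = #|J|],
    [(dx_I, dx_J)] is the determinant of the products [(dx_a, dx_b)], [a] in [I]
    and [b] in [J].  The default value of [nth] is never used. *)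
Definition minor (R : realType) (n : nat) (G : 'M[R]_n) (I J : {set 'I_n}) : R :=
  \det (\matrix_(a < #|I|, b < #|I|)
          G (enum_val a) (nth (enum_val a) (enum J) b)).

Definition herm (R : realType) (n : nat) (G : 'M[R]_n) (alpha beta : ext R n)
    : R[i] :=
  \sum_(I : {set 'I_n}) \sum_(J : {set 'I_n} | #|J| == #|I|)
     (minor G I J)%:C%C * (alpha I : R[i]) * (beta J : R[i])^*.

Definition is_adjoint (R : realType) (n : nat) (G : 'M[R]_n)
    (f f' : 'End(ext R n)) : Prop :=
  forall alpha beta, herm G (f alpha) beta = herm G alpha (f' beta).

(** The form [< , >] attached to the volume form [Omega], extended from
    homogeneous forms to all forms. *)
Definition vol_form (R : realType) (n : nat) (G : 'M[R]_n) (Omega : ext R n)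
    (alpha beta : ext R n) : R[i] :=
  \sum_(a < n.+1) \sum_(b < n.+1)
     'i ^+ (a * b) *
     herm G (wedge (homog a alpha) (ext_conj (homog b beta))) Omega.

Definition preserves_form (T : Type) (K : zmodType) (form : T -> T -> K)
    (phi : T -> T) : Prop :=
  forall alpha beta, form (phi alpha) beta + form alpha (phi beta) = 0.

(** * Real Lie algebras inside complex vector spaces *)

Definition real_lie_subalgebra (R : realType) (V : lmodType R[i])
    (br : V -> V -> V) (A : set V) : Prop :=
  [/\ A 0, forall x y, A x -> A y -> A (x + y),
      forall (a : R) x, A x -> A (a%:C%C *: x)
    & forall x y, A x -> A y -> A (br x y)].

Definition real_lie_generated (R : realType) (V : lmodType R[i])
    (br : V -> V -> V) (S : set V) : set V :=
  smallest (real_lie_subalgebra br) S.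

Definition real_lie_isomorphic (R : realType) (V W : lmodType R[i])
    (brV : V -> V -> V) (brW : W -> W -> W) (A : set V) (B : set W) : Prop :=
  exists f : V -> W,
    [/\ set_bij A B f,
        forall x y, A x -> A y -> f (x + y) = f x + f y,
        forall (a : R) x, A x -> f (a%:C%C *: x) = a%:C%C *: f x
      & forall x y, A x -> A y -> f (brV x y) = brW (f x) (f y)].

Definition end_bracket (R : realType) (V : vectType R[i]) (f g : 'End(V))
    : 'End(V) := (f \o g)%VF - (g \o f)%VF.

Definition mx_bracket (R : realType) (n : nat) (M N : 'M[R[i]]_n)
    : 'M[R[i]]_n := M *m N - N *m M.

Definition su (R : realType) (p q : nat) : set 'M[R[i]]_(p + q) :=
  let H : 'M[R[i]]_(p + q) := block_mx 1%:M 0 0 (- 1%:M) in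
  [set M | (map_mx Num.conj M)^T *m H + H *m M = 0 /\ \tr M = 0].

(** * The operators and Lie algebras at a point

    [v] is an adapted coframe at the point and [G] the Gram matrix of the
    coordinate covectors.  The orientation of [W_0] is the one given by [v]. *)

Definition E_op (R : realType) (s : nat) (v : coframe R s)
    (i : 'I_2) (j : 'I_s.+1) : 'End(ext R (2 * s.+1)) :=
  linfun (wedge (one_form (v i j))).

Definition L_op (R : realType) (s : nat) (v : coframe R s) (j k : 'I_s.+1)
    : 'End(ext R (2 * s.+1)) :=
  \sum_(i < 2) (E_op v i j \o E_op v i k)%VF.

Definition V_op (R : realType) (s : nat) (v : coframe R s) (j : 'I_s.+1)
    : 'End(ext R (2 * s.+1)) :=
  (E_op v ord0 j \o E_op v ord_max j)%VF.

Definition Omega (R : realType) (s : nat) (v : coframe R s)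
    : ext R (2 * s.+1) :=
  \big[@wedge R _/@ext1 R _]_(j < s.+1)
    wedge (one_form (v ord0 j)) (one_form (v ord_max j)).

Definition LV_ops (R : realType) (s : nat) (v : coframe R s)
    : set 'End(ext R (2 * s.+1)) :=
  [set f | (exists j k, j != k /\ f = L_op v j k) \/ (exists j, f = V_op v j)].

(** The operators [L_jk], [V_j] and their adjoints [Lambda_jk], [A_j]. *)
Definition sKahler_ops (R : realType) (s : nat) (G : 'M[R]_(2 * s.+1))
    (v : coframe R s) : set 'End(ext R (2 * s.+1)) :=
  LV_ops v `|` [set f' | exists2 f, LV_ops v f & is_adjoint G f f'].

(** Operators on the real exterior algebra are identified with their
    complex-linear extensions. *)
Definition lieL_real (R : realType) (s : nat) (G : 'M[R]_(2 * s.+1))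
    (v : coframe R s) : set 'End(ext R (2 * s.+1)) :=
  real_lie_generated (@end_bracket R _) (sKahler_ops G v).

(** As the elements of [lieL_real] are real operators, the sum of [lieL_real]
    and ['i *: lieL_real] is direct, hence is the complexification. *)
Definition lieL_complex (R : realType) (s : nat) (G : 'M[R]_(2 * s.+1))
    (v : coframe R s) : set 'End(ext R (2 * s.+1)) :=
  [set f | exists g h,
     [/\ lieL_real G v g, lieL_real G v h & f = g + ('i : R[i]) *: h]].

Definition lie_uL (R : realType) (s : nat) (G : 'M[R]_(2 * s.+1))
    (v : coframe R s) : set 'End(ext R (2 * s.+1)) :=
  real_lie_generated (@end_bracket R _)
    [set ('i : R[i]) *: f | f in sKahler_ops G v].

(* Main.v *)
(** Let m = s + 1, and write E_ij for the wedge product with v_ij and I_ij for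
    its adjoint contraction. The operators E_1j + i E_2j and (I_1j + i I_2j) /
    2 have weight -i under the derivation J, and their duals (I_1j - i I_2j) /
    2 and E_1j - i E_2j have weight i: together they are 2m raising operators
    a_x and 2m lowering operators b_x satisfying the canonical anticommutation
    relations, so that M |-> sum M_xy a_x b_y is a faithful representation of
    gl(2m). The operators L_jk, V_j, Lambda_jk, A_j are images of off-diagonal
    block matrices, and the generators of uL generate, through brackets that
    need three distinct indices, the Lie algebra of all trace-zero matrices
    skew for [[0, 1], [-1, 0]], which is conjugate to su(m, m).

    For the form < , >, the wedge product with a real covector is its own adjoint
    up to the constant c = i^(2m - 1), and a contraction up to the conjugate of
    c.  As c^2 = -1, products of two anticommuting such operators are symmetric,
    and the generators of uL preserve the form.  Conversely an operator of the
    complexified algebra is x + i y with x, y in uL; if it preserves the form, so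
    does i y, hence y is both symmetric and skew, and y = 0 by nondegeneracy. *)

Require Import Defs.
From HB Require Import structures.
From mathcomp Require Import all_boot all_order all_algebra.
From mathcomp Require Import complex.
From mathcomp Require Import all_classical all_reals all_analysis.
From mathcomp Require Import ring.

Set Implicit Arguments.
Unset Strict Implicit.
Unset Printing Implicit Defensive.

Import Order.TTheory GRing.Theory Num.Theory.
Local Open Scope classical_set_scope.
Local Open Scope ring_scope.

(** * Real Lie subalgebras *)

Section RealLieSubalgebras.
Variables (R : realType) (V : lmodType R[i]) (br : V -> V -> V).
Implicit Types (A S : set V).

Lemma real_lie_generated_sub S : S `<=` real_lie_generated br S.
Proof. exact: sub_gen_smallest. Qed.

Lemma real_lie_generated_min S A :
  real_lie_subalgebra br A -> S `<=` A -> real_lie_generated br S `<=` A.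
Proof. exact: smallest_sub. Qed.

Lemma real_lie_generated_closed S :
  real_lie_subalgebra br (real_lie_generated br S).
Proof.
split=> [A [[]] //|x y Sx Sy A AS|a x Sx A AS|x y Sx Sy A AS].
- by case: (AS) => -[_ AD _ _] _; apply: AD; [exact: Sx|exact: Sy].
- by case: (AS) => -[_ _ AZ _] _; apply: AZ; exact: Sx.
- by case: (AS) => -[_ _ _ Abr] _; apply: Abr; [exact: Sx|exact: Sy].
Qed.

Variable A : set V.
Hypothesis hA : real_lie_subalgebra br A.

Lemma real_lie_sum (I : Type) (r : seq I) (P : pred I) (F : I -> V) :
  (forall i, P i -> A (F i)) -> A (\sum_(i <- r | P i) F i).
Proof. by case: hA => A0 AD _ _; exact: big_ind. Qed.

Lemma real_lie_oppr x : A x -> A (- x).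
Proof.
case: hA => _ _ AZ _ /(AZ (-1)).
by rewrite rmorphN1 scaleN1r.
Qed.

Lemma real_lie_subr x y : A x -> A y -> A (x - y).
Proof. by case: hA => _ AD _ _ Ax /real_lie_oppr; exact: AD. Qed.

End RealLieSubalgebras.

(** * Preimages and images of real Lie subalgebras *)

Section RealLieMorphisms.
Variables (R : realType) (V W : lmodType R[i]).
Variables (brV : V -> V -> V) (brW : W -> W -> W) (f : {linear V -> W}).
Hypothesis f_br : {morph f : x y / brV x y >-> brW x y}.

Lemma real_lie_preimage B :
  real_lie_subalgebra brW B -> real_lie_subalgebra brV (f @^-1` B).
Proof.
case=> B0 BD BZ Bbr; split=> /= [|x y Bx By|a x Bx|x y Bx By].
- by rewrite raddf0.
- by rewrite raddfD; exact: BD.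
- by rewrite linearZ; exact: BZ.
- by rewrite f_br; exact: Bbr.
Qed.

Lemma real_lie_image A :
  real_lie_subalgebra brV A -> real_lie_subalgebra brW (f @` A).
Proof.
case=> A0 AD AZ Abr; split=> [|_ _ [x Ax <-] [y Ay <-]|a _ [x Ax <-]|
                              _ _ [x Ax <-] [y Ay <-]].
- by exists 0; rewrite ?raddf0.
- by exists (x + y); rewrite ?raddfD //; exact: AD.
- by exists (a%:C%C *: x); rewrite ?linearZ //; exact: AZ.
- by exists (brV x y); rewrite ?f_br //; exact: Abr.
Qed.

End RealLieMorphisms.

(** * Complexification of a real Lie algebra of operators *)

Section EndBracket.
Variables (R : realType) (V : vectType R[i]).
Implicit Types f g h : 'End(V).

Lemma end_bracketDl f g h :
  end_bracket (f + g) h = end_bracket f h + end_bracket g h.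
Proof. by rewrite /end_bracket comp_lfunDl comp_lfunDr opprD addrACA. Qed.

Lemma end_bracketDr f g h :
  end_bracket h (f + g) = end_bracket h f + end_bracket h g.
Proof. by rewrite /end_bracket comp_lfunDl comp_lfunDr opprD addrACA. Qed.

Lemma end_bracketZl a f g : end_bracket (a *: f) g = a *: end_bracket f g.
Proof. by rewrite /end_bracket -comp_lfunZl -comp_lfunZr scalerBr. Qed.

Lemma end_bracketZr a f g : end_bracket f (a *: g) = a *: end_bracket f g.
Proof. by rewrite /end_bracket -comp_lfunZl -comp_lfunZr scalerBr. Qed.

Definition complexification (A : set 'End(V)) : set 'End(V) :=
  [set f | exists g h, [/\ A g, A h & f = g + ('i : R[i]) *: h]].

(** The bracket of [x + 'i *: y] and [z + 'i *: w] has the parts [[x, z] - [y, w]] and [[x, w] +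
    [y, z]]. This serves twice: for [lieL_complex], and to place [lieL_real] inside the
    complexification of [lie_uL]. *)
Lemma complexification_closed A :
  real_lie_subalgebra (@end_bracket R V) A ->
  real_lie_subalgebra (@end_bracket R V) (complexification A).
Proof.
move=> hA; have [A0 AD AZ Abr] := hA; split.
- by exists 0, 0; rewrite scaler0 addr0.
- move=> _ _ [x [y [Ax Ay ->]]] [z [w [Az Aw ->]]].
  exists (x + z), (y + w); split; [exact: AD|exact: AD|].
  by rewrite scalerDr addrACA.
- move=> a _ [x [y [Ax Ay ->]]]; exists (a%:C%C *: x), (a%:C%C *: y).
  split; [exact: AZ|exact: AZ|].
  by rewrite scalerDr !scalerA mulrC.
- move=> _ _ [x [y [Ax Ay ->]]] [z [w [Az Aw ->]]].
  exists (end_bracket x z - end_bracket y w),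
         (end_bracket x w + end_bracket y z); split.
  + by apply: (real_lie_subr hA); exact: Abr.
  + by apply: AD; exact: Abr.
  rewrite !(end_bracketDl, end_bracketDr, end_bracketZl, end_bracketZr).
  rewrite scalerA -expr2 sqrCi scaleN1r [in RHS]scalerDr.
  by rewrite [X in _ + X = _]addrC addrACA.
Qed.

End EndBracket.

(** * Generators of su(m, m) *)

Lemma conjC_real (R : realType) (a : R) : (a%:C%C : R[i])^* = a%:C%C.
Proof. by rewrite conj_Creal //; apply/complex_realP; exists a. Qed.

Section UnitaryLie.
Variable R : realType.
Local Notation C := R[i].

Definition adjmx m n (M : 'M[C]_(m, n)) : 'M[C]_(n, m) :=
  (map_mx Num.conj M)^T.

Lemma adjmxD m n (M N : 'M[C]_(m, n)) : adjmx (M + N) = adjmx M + adjmx N.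
Proof. by rewrite /adjmx map_mxD linearD. Qed.

Lemma adjmxN m n (M : 'M[C]_(m, n)) : adjmx (- M) = - adjmx M.
Proof. by rewrite /adjmx map_mxN linearN. Qed.

Lemma adjmxZ m n a (M : 'M[C]_(m, n)) : adjmx (a *: M) = a^* *: adjmx M.
Proof. by rewrite /adjmx map_mxZ linearZ. Qed.

Lemma adjmx0 m n : adjmx (0 : 'M[C]_(m, n)) = 0.
Proof. by rewrite /adjmx map_mx0 trmx0. Qed.

Lemma adjmxM m n p (M : 'M[C]_(m, n)) (N : 'M[C]_(n, p)) :
  adjmx (M *m N) = adjmx N *m adjmx M.
Proof. by rewrite /adjmx map_mxM trmx_mul. Qed.

Lemma adjmx_delta m n i j : adjmx (delta_mx i j : 'M[C]_(m, n)) = delta_mx j i.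
Proof. by rewrite /adjmx map_delta_mx trmx_delta. Qed.

Definition special_unitary n (H : 'M[C]_n) : set 'M[C]_n :=
  [set M | adjmx M *m H + H *m M = 0 /\ \tr M = 0].

Lemma special_unitary_closed n (H : 'M[C]_n) :
  real_lie_subalgebra (@mx_bracket R n) (special_unitary H).
Proof.
split=> [|M N [HM tM] [HN tN]|a M [HM tM]|M N [HM tM] [HN tN]]; split.
- by rewrite adjmx0 mul0mx mulmx0 addr0.
- exact: mxtrace0.
- by rewrite adjmxD mulmxDl mulmxDr addrACA HM HN addr0.
- by rewrite mxtraceD tM tN addr0.
- by rewrite adjmxZ conjC_real -scalemxAl -scalemxAr -scalerDr HM scaler0.
- by rewrite mxtraceZ tM mulr0.
- rewrite /mx_bracket adjmxD adjmxN !adjmxM mulmxDl mulmxDr mulNmx mulmxN.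
  have eM : adjmx M *m H = - (H *m M) by apply/eqP; rewrite -addr_eq0 HM.
  have eN : adjmx N *m H = - (H *m N) by apply/eqP; rewrite -addr_eq0 HN.
  rewrite -!(mulmxA (adjmx _)) eM eN !mulmxN !mulmxA eM eN !mulNmx !opprK.
  by rewrite -[X in X + _]opprB addNr.
- by rewrite /mx_bracket raddfB /= mxtrace_mulC subrr.
Qed.

Variable m : nat.
Implicit Types A B : 'M[C]_m.

(* The Lie algebra of the form [[0, 1], [-1, 0]] consists of the sums
   [dg A + up B + dn D] with [B], [D] Hermitian; the trace vanishes iff
   [\tr A] is real. *)
Definition up B : 'M[C]_(m + m) := block_mx 0 B 0 0.
Definition dn B : 'M[C]_(m + m) := block_mx 0 0 B 0.
Definition dg A : 'M[C]_(m + m) := block_mx A 0 0 (- adjmx A).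

Lemma upD : {morph up : A B / A + B}.
Proof. by move=> A B; rewrite /up add_block_mx !addr0. Qed.
Lemma dnD : {morph dn : A B / A + B}.
Proof. by move=> A B; rewrite /dn add_block_mx !addr0. Qed.
Lemma dgD : {morph dg : A B / A + B}.
Proof. by move=> A B; rewrite /dg add_block_mx !addr0 adjmxD opprD. Qed.
Lemma upZ a B : up (a *: B) = a *: up B.
Proof. by rewrite /up scale_block_mx !scaler0. Qed.
Lemma dnZ a B : dn (a *: B) = a *: dn B.
Proof. by rewrite /dn scale_block_mx !scaler0. Qed.
Lemma dgZ (a : R) A : dg (a%:C%C *: A) = a%:C%C *: dg A.
Proof.
by rewrite /dg scale_block_mx !scaler0 adjmxZ conjC_real scalerN.
Qed.
Lemma up0 : up 0 = 0. Proof. by rewrite /up block_mx0. Qed.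
Lemma dn0 : dn 0 = 0. Proof. by rewrite /dn block_mx0. Qed.
Lemma dg0 : dg 0 = 0. Proof. by rewrite /dg adjmx0 oppr0 block_mx0. Qed.

Lemma dnN A : dn (- A) = - dn A.
Proof. by rewrite /dn opp_block_mx !oppr0. Qed.
Lemma dgN A : dg (- A) = - dg A.
Proof. by rewrite /dg opp_block_mx !oppr0 adjmxN. Qed.

(** The bracket has the diagonal blocks [B *m A] and [- (A *m B)]; the hypothesis, satisfied by
    Hermitian [A] and [B], makes the second block the partner of the first in [dg]. *)
Lemma br_up_dn B A : adjmx (B *m A) = A *m B ->
  mx_bracket (up B) (dn A) = dg (B *m A).
Proof.
rewrite /mx_bracket /up /dn /dg !mulmx_block !(mulmx0, mul0mx, addr0, add0r) => ->.
by rewrite opp_block_mx add_block_mx !(oppr0, addr0, add0r).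
Qed.

Lemma br_dg_up A B : mx_bracket (dg A) (up B) = up (A *m B + B *m adjmx A).
Proof.
rewrite /mx_bracket /up /dg !mulmx_block !(mulmx0, mul0mx, addr0, add0r).
by rewrite opp_block_mx add_block_mx !(oppr0, addr0, add0r) mulmxN opprK.
Qed.

Lemma br_dg_dn A B : mx_bracket (dg A) (dn B) = dn (- (adjmx A *m B + B *m A)).
Proof.
rewrite /mx_bracket /dn /dg !mulmx_block !(mulmx0, mul0mx, addr0, add0r).
by rewrite opp_block_mx add_block_mx !(oppr0, addr0, add0r) mulNmx opprD.
Qed.

Lemma br_dg_dg A B : mx_bracket (dg A) (dg B) = dg (A *m B - B *m A).
Proof.
rewrite /mx_bracket /dg !mulmx_block !(mulmx0, mul0mx, addr0, add0r).
rewrite opp_block_mx add_block_mx !(oppr0, addr0, add0r).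
by rewrite !(mulmxN, mulNmx, opprK) adjmxD adjmxN !adjmxM opprB addrC.
Qed.

End UnitaryLie.

(** * Generation of the special unitary algebra of the split form *)

Section SplitUnitaryGenerators.
Variables (R : realType) (m : nat).
Local Notation C := R[i].
Local Notation e := (@delta_mx C m m).

Lemma complex_rect (x : C) :
  x = (complex.Re x)%:C%C + 'i * (complex.Im x)%:C%C.
Proof. by rewrite {1}[x]complexE complexiE. Qed.

Lemma conjC_rect (x : C) :
  x^* = (complex.Re x)%:C%C - 'i * (complex.Im x)%:C%C.
Proof.
by rewrite {1}[x]complex_rect rmorphD rmorphM /= !conjC_real conjCi mulNr.
Qed.

(** Twice [B] is [B + adjmx B], where an entry [x + 'i * y] at [j], [k] and its conjugate at [k],
    [j] contribute [x] times [e j k + e k j] and [y] times ['i *: (e j k - e k j)]. *)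
Lemma hermitian_span (P : set 'M[C]_m) :
  P 0 -> (forall A B, P A -> P B -> P (A + B)) ->
  (forall (a : R) A, P A -> P (a%:C%C *: A)) ->
  (forall j k, P (e j k + e k j)) ->
  (forall j k, P ('i *: (e j k - e k j))) ->
  forall B, adjmx B = B -> P B.
Proof.
move=> P0 PD PZ Pre Pim B hB.
have -> : B = (2^-1 : R)%:C%C *: \sum_j \sum_k
    ((complex.Re (B j k))%:C%C *: (e j k + e k j) +
     (complex.Im (B j k))%:C%C *: ('i *: (e j k - e k j))).
  have -> : (2^-1 : R)%:C%C = 2^-1 :> C by rewrite fmorphV rmorph_nat.
  apply: (scalerI (a := 2)); first by rewrite pnatr_eq0.
  rewrite scalerA divff ?pnatr_eq0 // scale1r scaler_nat mulr2n.
  rewrite -{2}hB {1 2}[B]matrix_sum_delta /adjmx.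
  rewrite raddf_sum linear_sum -big_split /=; apply: eq_bigr => j _.
  rewrite raddf_sum linear_sum -big_split /=; apply: eq_bigr => k _.
  rewrite map_mxZ linearZ /= map_delta_mx trmx_delta.
  rewrite {1}[B j k]complex_rect conjC_rect.
  move: (complex.Re _)%:C%C (complex.Im _)%:C%C (e j k) (e k j) => a b x y.
  by rewrite scalerDl scalerBl addrACA -scalerDr -scalerBr scalerA [b * 'i]mulrC.
apply: (PZ); apply: big_ind => // j _; apply: big_ind => // k _.
by apply: PD; exact: PZ.
Qed.

(** Multiplied by ['i], this skew form becomes Hermitian of signature (m, m), so its special unitary
    algebra is a model of su(m, m). *)
Definition split_form : 'M[C]_(m + m) := block_mx 0 1%:M (- 1%:M) 0.

Lemma up_unitary B : adjmx B = B -> special_unitary split_form (up B).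
Proof.
move=> hB; split; last by rewrite mxtrace_block !mxtrace0 addr0.
rewrite {1}/adjmx map_block_mx tr_block_mx -!/(adjmx _) hB !adjmx0 !mulmx_block.
rewrite !(mulmx0, mul0mx, addr0, add0r, mulmx1, mul1mx, mulmxN, mulNmx).
by rewrite add_block_mx !(oppr0, addr0) subrr block_mx0.
Qed.

Lemma dn_unitary B : adjmx B = B -> special_unitary split_form (dn B).
Proof.
move=> hB; split; last by rewrite mxtrace_block !mxtrace0 addr0.
rewrite {1}/adjmx map_block_mx tr_block_mx -!/(adjmx _) hB !adjmx0 !mulmx_block.
rewrite !(mulmx0, mul0mx, addr0, add0r, mulmx1, mul1mx, mulmxN, mulNmx).
by rewrite add_block_mx !(oppr0, addr0) addNr block_mx0.
Qed.

Lemma hermitian_delta_antisym j k :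
  adjmx ('i *: (e j k - e k j)) = 'i *: (e j k - e k j).
Proof.
by rewrite adjmxZ adjmxD adjmxN !adjmx_delta conjCi scaleNr -scalerN opprB.
Qed.

Lemma split_form_lie (M : 'M[C]_(m + m)) : special_unitary split_form M ->
  exists A B D, [/\ M = dg A + up B + dn D, adjmx B = B, adjmx D = D
                  & \sum_j (complex.Im (A j j))%:C%C = 0 :> C].
Proof.
rewrite -[M]submxK; set A := ulsubmx M; set B := ursubmx M.
set D := dlsubmx M; set E := drsubmx M => -[].
rewrite {1}/adjmx map_block_mx tr_block_mx -!/(adjmx _) /split_form.
rewrite !mulmx_block !(mulmx0, mul0mx, addr0, add0r, mulmx1, mul1mx, mulmxN, mulNmx).
rewrite add_block_mx -[X in _ = X](@block_mx0 _ m m m m) => /eq_block_mx[hD hE _ hB].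
have eE : E = - adjmx A by rewrite -[E]opprK; congr (- _); apply/esym/eqP; rewrite -addr_eq0 hE.
rewrite mxtrace_block eE raddfN /= => hT.
exists A, B, D; split.
- by rewrite /dg /up /dn !add_block_mx !(addr0, add0r).
- by apply/eqP; rewrite -subr_eq0 hB.
- by apply/eqP; rewrite -subr_eq0 -oppr_eq0 opprB addrC hD.
(* The trace of [M] is [\tr A] minus its conjugate, which is ['i *+ 2] times the sum of the
   imaginary parts of the diagonal of [A]. *)
apply: (mulIf (x := 'i *+ 2)); first by rewrite mulrn_eq0 /= neq0Ci.
rewrite mul0r -[RHS]hT /mxtrace mulr_suml -sumrB; apply: eq_bigr => j _.
have -> : adjmx A j j = (A j j)^* by rewrite /adjmx !mxE.
rewrite conjC_rect [X in _ = X - _]complex_rect; ring.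
Qed.

(** Brackets of the given [up] and [dn] matrices fill the block-diagonal part, first with the
    [dg (e j j)], then with the imaginary and the real off-diagonal elementary matrices. Brackets of
    these with [up (e k k)] and [dn (e k k)] give the missing real symmetric matrices, and
    [hermitian_span] the rest of the off-diagonal blocks. *)
Lemma split_form_generated (A : set 'M[C]_(m + m)) : (2 < m)%N ->
  real_lie_subalgebra (@mx_bracket R (m + m)) A ->
  (forall j, A (up (e j j))) -> (forall j, A (dn (e j j))) ->
  (forall j k, j != k -> A (up ('i *: (e j k - e k j)))) ->
  (forall j k, j != k -> A (dn ('i *: (e j k - e k j)))) ->
  special_unitary split_form `<=` A.
Proof.
move=> m3 hA Aup Adn Aupi Adni; have [A0 AD AZ Abr] := hA.
have eM i j k l : e i j *m e k l = e i l *+ (j == k).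
  by rewrite mul_delta_mx_cond.
have Adgjj j : A (dg (e j j)).
  have <- : mx_bracket (up (e j j)) (dn (e j j)) = dg (e j j).
    by rewrite br_up_dn ?adjmxM ?adjmx_delta // eM eqxx.
  exact: Abr.
have Adgi j k : j != k -> A (dg ('i *: e j k)).
  move=> jk; rewrite (_ : dg _ =
      mx_bracket (up (e j j)) (dn ('i *: (e j k - e k j)))).
    by apply: Abr => //; exact: Adni.
  have h : e j j *m ('i *: (e j k - e k j)) = 'i *: e j k.
    by rewrite -scalemxAr mulmxBr !eM eqxx (negPf jk) subr0.
  rewrite br_up_dn h // adjmxZ adjmx_delta -scalemxAl mulmxBl !eM eqxx.
  by rewrite eq_sym (negPf jk) sub0r scalerN conjCi scaleNr.
(* The real elementary matrices come from products through a third index [l]: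
   this is where [2 < m] matters. *)
have Adg j k : A (dg (e j k)).
  have [->|jk] := eqVneq j k; first exact: Adgjj.
  have [l /andP[lj lk]] : exists l : 'I_m, (l != j) && (l != k).
    have : (0 < #|~: [set j; k]%SET|)%N.
      by rewrite cardsCs finset.setCK card_ord subn_gt0 cards2 jk.
    by case/card_gt0P => l; rewrite !inE negb_or; exists l.
  rewrite -[dg _]opprK; apply: (real_lie_oppr hA).
  rewrite (_ : - _ = mx_bracket (up ('i *: (e j l - e l j)))
                       (dn ('i *: (e l k - e k l)))).
    by apply: Abr; [apply: Aupi; rewrite eq_sym|exact: Adni].
  have h : ('i *: (e j l - e l j)) *m ('i *: (e l k - e k l)) = - e j k.
    rewrite -scalemxAl -scalemxAr scalerA -expr2 sqrCi scaleN1r; congr (- _).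
    rewrite mulmxBl !mulmxBr !eM eqxx (negPf lk) (negPf jk).
    by rewrite eq_sym (negPf lj) !subr0.
  rewrite br_up_dn h ?dgN //.
  rewrite adjmxN adjmx_delta.
  rewrite -scalemxAl -scalemxAr scalerA -expr2 sqrCi scaleN1r; congr (- _).
  rewrite mulmxBl !mulmxBr !eM eqxx (negPf lj) [k == j]eq_sym (negPf jk).
  by rewrite [k == l]eq_sym (negPf lk) !(mulr0n, mulr1n, sub0r, oppr0, opprK).
have Aup2 j k : A (up (e j k + e k j)).
  have [->|jk] := eqVneq j k; first by rewrite upD; exact: AD.
  have <- : mx_bracket (dg (e j k)) (up (e k k)) = up (e j k + e k j).
    by rewrite br_dg_up adjmx_delta !eM eqxx.
  exact: Abr.
have Adn2 j k : A (dn (e j k + e k j)).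
  have [->|jk] := eqVneq j k; first by rewrite dnD; exact: AD.
  rewrite (_ : dn _ = - mx_bracket (dg (e k j)) (dn (e k k))).
    by apply: (real_lie_oppr hA); exact: Abr.
  by rewrite br_dg_dn adjmx_delta !eM eqxx dnN opprK.
have Aupi2 j k : A (up ('i *: (e j k - e k j))).
  have [->|/Aupi//] := eqVneq j k.
  by rewrite subrr scaler0 up0.
have Adni2 j k : A (dn ('i *: (e j k - e k j))).
  have [->|/Adni//] := eqVneq j k.
  by rewrite subrr scaler0 dn0.
move=> _ /split_form_lie[B [D [E [-> hD hE hT]]]].
apply: (AD); last first.
  apply: (hermitian_span (P := A \o @dn R m)) => //=; first by rewrite dn0.
  - by move=> x y Ax Ay; rewrite dnD; exact: AD.
  - by move=> a x Ax; rewrite dnZ; exact: AZ.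
apply: (AD); last first.
  apply: (hermitian_span (P := A \o @up R m)) => //=; first by rewrite up0.
  - by move=> x y Ax Ay; rewrite upD; exact: AD.
  - by move=> a x Ax; rewrite upZ; exact: AZ.
(* A base index. As the imaginary parts of the diagonal of [B] sum to zero, each ['i *: e j j] can
   be replaced by ['i *: (e j j - e o o)], which is a bracket of off-diagonal matrices already
   obtained. *)
pose o : 'I_m := Ordinal (ltn_trans (isT : 0 < 2)%N m3).
have -> : B = \sum_j \sum_k ((complex.Re (B j k))%:C%C *: e j k +
    (complex.Im (B j k))%:C%C *: ('i *: (e j k - e o o *+ (j == k)))).
  have h : \sum_j \sum_k (complex.Im (B j k))%:C%C *: ('i *: (e o o *+ (j == k))) = 0.
    rewrite (eq_bigr (fun j => (complex.Im (B j j))%:C%C *: ('i *: e o o))).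
      by rewrite -scaler_suml hT scale0r.
    move=> j _; rewrite (bigD1 j) //= eqxx big1 ?addr0 // => k kj.
    by rewrite eq_sym (negPf kj) !scaler0.
  rewrite -[LHS]subr0 -[X in _ - X = _]h [X in X - _ = _]matrix_sum_delta -sumrB.
  apply: eq_bigr => j _; rewrite -!sumrB; apply: eq_bigr => k _.
  rewrite {1}[B j k]complex_rect scalerDl -addrA; congr (_ + _).
  by rewrite mulrC -scalerA -!scalerBr.
rewrite (big_morph _ (@dgD R m) (@dg0 R m)).
apply: (real_lie_sum hA) => j _.
rewrite (big_morph _ (@dgD R m) (@dg0 R m)).
apply: (real_lie_sum hA) => k _; rewrite dgD !dgZ.
apply: AD; apply: AZ => //.
have [<-|jk] := eqVneq j k; last by rewrite subr0; exact: Adgi.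
have [->|jo] := eqVneq j o; first by rewrite subrr scaler0 dg0.
have <- : mx_bracket (dg ('i *: e j o)) (dg (e o j)) = dg ('i *: (e j j - e o o)).
  by rewrite br_dg_dg -scalemxAl -scalemxAr !eM !eqxx scalerBr.
by apply: Abr => //; exact: Adgi.
Qed.

End SplitUnitaryGenerators.

(** * Quadratic expressions in anticommuting operators *)

Section QuadraticOperators.
Variables (K : fieldType) (A : algType K) (N : nat) (a b : 'I_N -> A).
Hypothesis anti_a : forall x y, a x * a y = - (a y * a x).
Hypothesis anti_b : forall x y, b x * b y = - (b y * b x).
Hypothesis anti_ab : forall x y, a x * b y + b y * a x = (x == y)%:R.

(** The second quantization of [M], the [a x] being creation and the [b y] annihilation
    operators. *)
Definition quad (M : 'M[K]_N) : A := \sum_x \sum_y M x y *: (a x * b y).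

Lemma quad_is_linear : linear quad.
Proof.
move=> c M M'; rewrite /quad scaler_sumr -big_split /=; apply: eq_bigr => x _.
rewrite scaler_sumr -big_split /=; apply: eq_bigr => y _.
by rewrite !mxE scalerDl scalerA.
Qed.

HB.instance Definition _ :=
  GRing.isLinear.Build K 'M[K]_N A *:%R quad quad_is_linear.

Lemma ba_swap x y : b y * a x = (x == y)%:R - a x * b y.
Proof. by rewrite -anti_ab addrAC subrr add0r. Qed.

(** Moving [a z] across [a x * b y] costs two signs, which cancel, and a contraction with [b y],
    which survives only for [y = z]. *)
Lemma quad_a M z : quad M * a z - a z * quad M = \sum_x M x z *: a x.
Proof.
rewrite /quad mulr_suml mulr_sumr -sumrB; apply: eq_bigr => x _.
rewrite mulr_suml mulr_sumr -sumrB (bigD1 z) //= big1 => [|y yz].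
  rewrite addr0 -scalerAl -scalerAr -scalerBr -mulrA ba_swap eqxx.
  by rewrite mulrBr mulr1 !mulrA [a z * a x]anti_a mulNr opprK subrK.
rewrite -scalerAl -scalerAr -scalerBr -mulrA ba_swap eq_sym (negPf yz) sub0r.
by rewrite mulrN !mulrA [a z * a x]anti_a mulNr opprK addNr scaler0.
Qed.

Lemma quad_b M w : quad M * b w - b w * quad M = - \sum_y M w y *: b y.
Proof.
rewrite /quad exchange_big /= mulr_suml mulr_sumr -sumrB -sumrN.
apply: eq_bigr => y _.
rewrite mulr_suml mulr_sumr -sumrB (bigD1 w) //= big1 => [|x xw].
  rewrite addr0 -scalerAl -scalerAr -scalerBr [b w * _]mulrA ba_swap eqxx.
  rewrite mulrBl mul1r -!mulrA [b y * b w]anti_b mulrN opprB.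
  by rewrite addrA addNr sub0r scalerN.
rewrite -scalerAl -scalerAr -scalerBr [b w * _]mulrA ba_swap (negPf xw) sub0r.
by rewrite mulNr -!mulrA [b y * b w]anti_b mulrN opprK addNr scaler0.
Qed.

(** The commutator with [quad M] is a derivation, so its value on [a z * b w] follows from [quad_a]
    and [quad_b]: [M] acts on the span of the [a x] by the standard representation and on that of
    the [b y] by the dual one. *)
Lemma quad_bracket M M' :
  quad (M *m M' - M' *m M) = quad M * quad M' - quad M' * quad M.
Proof.
have h z w : quad M * (a z * b w) - (a z * b w) * quad M =
    \sum_x M x z *: (a x * b w) - \sum_y M w y *: (a z * b y).
  transitivity ((quad M * a z - a z * quad M) * b w +
                a z * (quad M * b w - b w * quad M)).
    by rewrite mulrBl mulrBr !mulrA addrA subrK.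
  rewrite quad_a quad_b mulrN mulr_suml mulr_sumr.
  by congr (_ - _); apply: eq_bigr => i _; rewrite -?scalerAl -?scalerAr.
rewrite raddfB /=.
transitivity (\sum_z \sum_w M' z w *: (\sum_x M x z *: (a x * b w) -
                                       \sum_y M w y *: (a z * b y))).
  under [RHS]eq_bigr do under eq_bigr do rewrite scalerBr.
  under [RHS]eq_bigr do rewrite sumrB.
  rewrite sumrB; congr (_ - _).
    rewrite /quad.
    under eq_bigr => x _ do under eq_bigr => w _ do rewrite mxE scaler_suml.
    under eq_bigr => x _ do rewrite exchange_big.
    rewrite exchange_big /=; apply: eq_bigr => z _.
    rewrite exchange_big /=; apply: eq_bigr => w _.
    by rewrite scaler_sumr; apply: eq_bigr => x _; rewrite scalerA mulrC.
  rewrite /quad; apply: eq_bigr => z _.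
  under eq_bigr => y _ do rewrite mxE scaler_suml.
  rewrite exchange_big /=; apply: eq_bigr => w _.
  by rewrite scaler_sumr; apply: eq_bigr => y _; rewrite scalerA.
rewrite [in RHS](_ : quad M' = \sum_z \sum_w M' z w *: (a z * b w)) //.
rewrite mulr_sumr mulr_suml -sumrB; apply: eq_bigr => z _.
rewrite mulr_sumr mulr_suml -sumrB; apply: eq_bigr => w _.
by rewrite -scalerAl -scalerAr -scalerBr -h.
Qed.

(** If [quad M] vanishes, so does [\sum_x M x w *: a x] by [quad_a], and the anticommutator of this
    sum with [b z] is the entry [M z w]. *)
Lemma quad_inj : injective quad.
Proof.
suff h M : quad M = 0 -> M = 0.
  by move=> M M' e; apply/eqP; rewrite -subr_eq0; apply/eqP/h; rewrite raddfB /= e subrr.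
move=> M0; apply/matrixP => z w; rewrite mxE.
have := quad_a M w; rewrite M0 mul0r mulr0 subrr => /esym s0.
have : \sum_x M x w *: (a x * b z + b z * a x) = 0.
  under eq_bigr do rewrite scalerDr scalerAl scalerAr.
  by rewrite big_split /= -mulr_suml -mulr_sumr s0 mul0r mulr0 addr0.
rewrite (bigD1 z) //= big1 => [|x xz].
  by rewrite addr0 anti_ab eqxx => /eqP; rewrite scaler_eq0 oner_eq0 orbF => /eqP.
by rewrite anti_ab (negPf xz) scaler0.
Qed.

End QuadraticOperators.

(** * From wedges and contractions to raising and lowering operators *)

Section ChargedOperators.
Variables (R : realType) (m : nat) (A : algType R[i]).
Local Notation C := R[i].
Variables e t : 'I_2 -> 'I_m -> A.
Hypothesis ee : forall i j i' j', e i j * e i' j' + e i' j' * e i j = 0.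
Hypothesis tt : forall i j i' j', t i j * t i' j' + t i' j' * t i j = 0.
Hypothesis et : forall i j i' j',
  e i j * t i' j' + t i' j' * e i j = ((i == i') && (j == j'))%:R.

Definition bilinear_ops : set A :=
  [set f | (exists j k, j != k /\ (f = \sum_(i < 2) e i j * e i k \/
                                   f = \sum_(i < 2) t i k * t i j)) \/
           (exists j, f = e ord0 j * e ord_max j \/
                      f = t ord_max j * t ord0 j)].

Let half : C := 2^-1.
(* [raise x] has weight [- 'i] and [lower x] weight ['i] under [J]; an
   index in the first half of ['I_(m + m)] stands for a wedge product in [raise]
   and for the dual contraction in [lower], and conversely in the second half. *)
Definition raise (x : 'I_(m + m)) : A :=
  match fintype.split x with
  | inl j => e ord0 j + ('i : C) *: e ord_max j
  | inr j => half *: (t ord0 j + ('i : C) *: t ord_max j)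
  end.
Definition lower (x : 'I_(m + m)) : A :=
  match fintype.split x with
  | inl j => half *: (t ord0 j - ('i : C) *: t ord_max j)
  | inr j => e ord0 j - ('i : C) *: e ord_max j
  end.

Let ac (x y : A) := x * y + y * x.
Let acC x y : ac x y = ac y x. Proof. exact: addrC. Qed.
Let acDl x y z : ac (x + y) z = ac x z + ac y z.
Proof. by rewrite /ac mulrDl mulrDr addrACA. Qed.
Let acDr x y z : ac z (x + y) = ac z x + ac z y.
Proof. by rewrite acC acDl !(acC z). Qed.
Let acZl c x y : ac (c *: x) y = c *: ac x y.
Proof. by rewrite /ac -scalerAl -scalerAr scalerDr. Qed.
Let acZr c x y : ac x (c *: y) = c *: ac x y.
Proof. by rewrite acC acZl acC. Qed.
Let acNr x y : ac x (- y) = - ac x y.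
Proof. by rewrite /ac mulrN mulNr opprD. Qed.

Let i01 : (ord0 == ord_max :> 'I_2) = false. Proof. by []. Qed.
Let i10 : (ord_max == ord0 :> 'I_2) = false. Proof. by []. Qed.

Let ee0 i j i' j' : ac (e i j) (e i' j') = 0. Proof. exact: ee. Qed.
Let tt0 i j i' j' : ac (t i j) (t i' j') = 0. Proof. exact: tt. Qed.
Let ete i j i' j' : ac (e i j) (t i' j') = ((i == i') && (j == j'))%:R.
Proof. exact: et. Qed.
Let tee i j i' j' : ac (t i j) (e i' j') = ((i == i') && (j == j'))%:R.
Proof. by rewrite acC ete eq_sym [j == _]eq_sym. Qed.

Let acNl x y : ac (- x) y = - ac x y.
Proof. by rewrite acC acNr acC. Qed.
Let ihi : 'i * half * 'i = - half.
Proof. by rewrite mulrAC -expr2 sqrCi mulN1r. Qed.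
Let hh : half + half = 1.
Proof. by rewrite -mulr2n -mulr_natr mulVf ?pnatr_eq0. Qed.
Let hii : half * 'i * 'i = - half.
Proof. by rewrite mulrAC -mulrA -expr2 sqrCi mulrN1. Qed.

(** These rules evaluate the anticommutator of any two linear combinations of the [e] and [t]. *)
Let acE := (acDl, acDr, acZl, acZr, acNr, acNl, ee0, tt0, ete, tee).

(** The one case with nonzero terms pairs a wedge with a contraction, where the contributions [half]
    and ['i * half * 'i] cancel. *)
Lemma raise_anti x y : raise x * raise y = - (raise y * raise x).
Proof.
apply/eqP; rewrite -addr_eq0 -/(ac _ _) /raise; apply/eqP.
case: (fintype.split x) => j; case: (fintype.split y) => k; rewrite !acE ?eqxx ?i01 ?i10 /=;
  rewrite ?(oppr0, scaler0, addr0, add0r) //.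
  by rewrite !scalerA -scalerDl ihi subrr scale0r.
by rewrite !scalerA -scalerDl hii subrr scale0r.
Qed.

Lemma lower_anti x y : lower x * lower y = - (lower y * lower x).
Proof.
apply/eqP; rewrite -addr_eq0 -/(ac _ _) /lower; apply/eqP.
case: (fintype.split x) => j; case: (fintype.split y) => k;
  rewrite !acE ?eqxx ?i01 ?i10 /= ?(oppr0, scaler0, addr0, add0r, opprK) //.
  by rewrite !scalerN opprK !scalerA -scalerDl hii subrr scale0r.
by rewrite !scalerN opprK !scalerA -scalerDl hii subrr scale0r.
Qed.

(** The opposite sign of ['i] in [lower] turns the cancellation in [raise_anti] into
    [half + half = 1], which explains the normalization by [half]. *)
Lemma raise_lower_anti x y : raise x * lower y + lower y * raise x = (x == y)%:R.
Proof.
rewrite -/(ac _ _) -[x in RHS]splitK -[y in RHS]splitK /raise /lower.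
case: (fintype.split x) => j; case: (fintype.split y) => k;
  rewrite !acE ?eqxx ?i01 ?i10 /= ?(oppr0, scaler0, addr0, add0r, opprK);
  rewrite ?(eq_lshift, eq_rshift, eq_lrshift, eq_rlshift) //.
  by rewrite ?scalerN !scalerA ihi scaleNr opprK -scalerDl hh scale1r.
by rewrite ?scalerN !scalerA hii scaleNr opprK -scalerDl hh scale1r.
Qed.

Lemma raise_lshift j : raise (lshift m j) = e ord0 j + ('i : C) *: e ord_max j.
Proof. by rewrite /raise (unsplitK (inl j)). Qed.
Lemma raise_rshift j :
  raise (rshift m j) = half *: (t ord0 j + ('i : C) *: t ord_max j).
Proof. by rewrite /raise (unsplitK (inr j)). Qed.
Lemma lower_lshift j :
  lower (lshift m j) = half *: (t ord0 j - ('i : C) *: t ord_max j).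
Proof. by rewrite /lower (unsplitK (inl j)). Qed.
Lemma lower_rshift j : lower (rshift m j) = e ord0 j - ('i : C) *: e ord_max j.
Proof. by rewrite /lower (unsplitK (inr j)). Qed.

Lemma quad_delta x y : quad raise lower (delta_mx x y) = raise x * lower y.
Proof.
rewrite /quad (bigD1 x) //= (bigD1 y) //= !big1 => [|x' hx|y' hy].
- by rewrite mxE !eqxx scale1r !addr0.
- by rewrite big1 // => y' _; rewrite mxE (negPf hx) scale0r.
- by rewrite mxE eqxx (negPf hy) scale0r.
Qed.

Lemma up_delta j k :
  up (delta_mx j k : 'M[C]_m) = delta_mx (lshift m j) (rshift m k).
Proof. by rewrite /up /block_mx row_mx0 delta_mx_ushift delta_mx_rshift. Qed.

Lemma dn_delta j k :
  dn (delta_mx j k : 'M[C]_m) = delta_mx (rshift m j) (lshift m k).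
Proof. by rewrite /dn /block_mx row_mx0 delta_mx_dshift delta_mx_lshift. Qed.

(** For anticommuting [w] the first summand is skew in [j] and [k] and the second symmetric:
    antisymmetrizing isolates the first, and setting [j = k] the second. *)
Lemma charged_product (w : 'I_2 -> 'I_m -> A) j k :
  (w ord0 j + ('i : C) *: w ord_max j) * (w ord0 k - ('i : C) *: w ord_max k) =
  \sum_(i < 2) w i j * w i k
  + ('i : C) *: (w ord_max j * w ord0 k - w ord0 j * w ord_max k).
Proof.
rewrite mulrDl !mulrBr -!scalerAl -!scalerAr scalerA -expr2 sqrCi scaleN1r opprK.
rewrite big_ord_recl big_ord1 scalerBr.
rewrite (_ : lift ord0 ord0 = ord_max); last exact/val_inj.
by rewrite [X in _ + X]addrC [X in _ = _ + X]addrC addrACA.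
Qed.

Section AntisymmetricProducts.
Variable w : 'I_2 -> 'I_m -> A.
Hypothesis ww : forall i j i' j', w i j * w i' j' + w i' j' * w i j = 0.

Let swap i j i' j' : w i j * w i' j' = - (w i' j' * w i j).
Proof. by apply/eqP; rewrite -addr_eq0 ww. Qed.

Lemma charged_product_antisym j k :
  (w ord0 j + ('i : C) *: w ord_max j) * (w ord0 k - ('i : C) *: w ord_max k) -
  (w ord0 k + ('i : C) *: w ord_max k) * (w ord0 j - ('i : C) *: w ord_max j) =
  (2 : C) *: \sum_(i < 2) w i j * w i k.
Proof.
rewrite !charged_product opprD addrACA -scalerBr.
rewrite [X in _ *: X](_ : _ = 0); last first.
  by rewrite [w ord_max k * _]swap [w ord0 k * _]swap opprK [- _ + _]addrC subrr.
rewrite scaler0 addr0 scaler_nat mulr2n -sumrN; congr (_ + _).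
by apply: eq_bigr => i _; rewrite swap opprK.
Qed.

Lemma charged_product_diag j :
  (w ord0 j + ('i : C) *: w ord_max j) * (w ord0 j - ('i : C) *: w ord_max j) =
  (- 2 : C) *: (('i : C) *: (w ord0 j * w ord_max j)).
Proof.
have w0 i : w i j * w i j = 0.
  apply: (scalerI (a := 2 : C)); first by rewrite pnatr_eq0.
  by rewrite scaler0 scaler_nat mulr2n ww.
rewrite charged_product big1 ?add0r // [w ord_max j * _]swap.
by rewrite -opprD -mulr2n -scaler_nat scalerN !scalerA -scaleNr mulNr ['i * _]mulrC.
Qed.

End AntisymmetricProducts.

Let q := quad raise lower.

Lemma quad_up_antisym j k :
  q (up ('i *: (delta_mx j k - delta_mx k j))) =
  (2 : C) *: (('i : C) *: \sum_(i < 2) e i j * e i k).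
Proof.
rewrite upZ upD -[- delta_mx _ _]scaleN1r upZ scaleN1r !up_delta /q.
rewrite linearZ linearB /= !quad_delta !raise_lshift !lower_rshift.
by rewrite charged_product_antisym // scalerA mulrC -scalerA.
Qed.

Lemma quad_up_diag j :
  q (up (delta_mx j j)) = (- 2 : C) *: (('i : C) *: (e ord0 j * e ord_max j)).
Proof.
by rewrite up_delta /q quad_delta raise_lshift lower_rshift charged_product_diag.
Qed.

Lemma quad_dn_antisym j k :
  q (dn ('i *: (delta_mx j k - delta_mx k j))) =
  (half : C) *: (('i : C) *: \sum_(i < 2) t i j * t i k).
Proof.
rewrite dnZ dnD -[- delta_mx _ _]scaleN1r dnZ scaleN1r !dn_delta /q.
rewrite linearZ linearB /= !quad_delta !raise_rshift !lower_lshift.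
rewrite -!scalerAl -!scalerAr -!scalerBr charged_product_antisym //.
rewrite !scalerA; congr (_ *: _).
by rewrite -mulrA mulVf ?pnatr_eq0 // mulr1 mulrC.
Qed.

Lemma quad_dn_diag j :
  q (dn (delta_mx j j)) = (- half : C) *: (('i : C) *: (t ord0 j * t ord_max j)).
Proof.
rewrite dn_delta /q quad_delta raise_rshift lower_lshift.
rewrite -!scalerAl -!scalerAr charged_product_diag // !scalerA; congr (_ *: _).
by rewrite mulrA mulrN -[half * half * 2]mulrA mulVf ?pnatr_eq0 // mulr1.
Qed.

Let br (x y : A) := x * y - y * x.

Lemma tt_swap i j i' j' : t i j * t i' j' = - (t i' j' * t i j).
Proof. by apply/eqP; rewrite -addr_eq0 tt. Qed.

(** The preimage of the generated algebra is a subalgebra containing the generating matrices, which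
    gives one inclusion. The image of the special unitary algebra is a subalgebra containing every
    generator, which gives the other. *)
Lemma bilinear_ops_generated : (2 < m)%N ->
  real_lie_generated br [set ('i : C) *: f | f in bilinear_ops] =
  q @` special_unitary (split_form R m).
Proof.
move=> m3; have q_br : {morph q : x y / mx_bracket x y >-> br x y}.
  move=> M N; rewrite /q /mx_bracket quad_bracket //.
  - exact: raise_anti.
  - exact: lower_anti.
  - exact: raise_lower_anti.
set S := [set _ | _ in _]; set L := real_lie_generated br S.
have hL : real_lie_subalgebra br L by exact: real_lie_generated_closed.
have LS f : bilinear_ops f -> L (('i : C) *: f).
  by move=> Of; apply: real_lie_generated_sub; exists f.
have LZ (a : C) f : a \is Num.real -> L f -> L (a *: f).
  by move=> /complex_realP[r ->]; case: hL => _ _ + _; apply.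
have LH : real_lie_subalgebra (@mx_bracket R (m + m)) (q @^-1` L).
  exact: real_lie_preimage.
rewrite eqEsubset; split; last first.
  move=> _ [M HM <-]; apply: (split_form_generated m3 LH _ _ _ _ HM) => /=.
  - move=> j; rewrite quad_up_diag; apply: LZ; first by rewrite realN realn.
    by apply: LS; right; exists j; left.
  - move=> j; rewrite quad_dn_diag tt_swap !scalerN scaleNr opprK.
    apply: LZ; first by rewrite realV realn.
    by apply: LS; right; exists j; right.
  - move=> j k jk; rewrite quad_up_antisym; apply: LZ; first exact: realn.
    by apply: LS; left; exists j, k; split=> //; left.
  - move=> j k jk; rewrite quad_dn_antisym; apply: LZ.
      by rewrite realV realn.
    (* The indices are exchanged because the adjoint products in [bilinear_ops] have reversed
       factors. *)
    apply: LS; left; exists k, j; split; first by rewrite eq_sym.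
    by right.
apply: real_lie_generated_min.
  by apply: real_lie_image => //; exact: special_unitary_closed.
have hI := real_lie_image q_br (special_unitary_closed (split_form R m)).
have IZ (a : C) f : a \is Num.real -> a != 0 ->
    (exists2 M, special_unitary (split_form R m) M & q M = a *: f) ->
    (q @` special_unitary (split_form R m)) f.
  move=> /complex_realP[r ->] r0 [M HM qM].
  have -> : f = (r^-1)%:C%C *: q M by rewrite fmorphV qM scalerK.
  by case: hI => _ _ IZ _; apply: IZ; exists M.
move=> _ [f + <-] => -[[j [k [jk [->|->]]]]|[j [->|->]]].
- apply: (IZ 2); [exact: realn|by rewrite pnatr_eq0|].
  exists (up ('i *: (delta_mx j k - delta_mx k j))).
    exact/up_unitary/hermitian_delta_antisym.
  exact: quad_up_antisym.
- apply: (IZ half); [by rewrite realV realn|by rewrite invr_eq0 pnatr_eq0|].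
  exists (dn ('i *: (delta_mx k j - delta_mx j k))).
    exact/dn_unitary/hermitian_delta_antisym.
  exact: quad_dn_antisym.
- apply: (IZ (-2)); [by rewrite realN realn|by rewrite oppr_eq0 pnatr_eq0|].
  exists (up (delta_mx j j)); last exact: quad_up_diag.
  by apply: up_unitary; rewrite adjmx_delta.
- apply: (IZ half); [by rewrite realV realn|by rewrite invr_eq0 pnatr_eq0|].
  exists (dn (delta_mx j j)); first by apply: dn_unitary; rewrite adjmx_delta.
  by rewrite /= quad_dn_diag tt_swap !scalerN scaleNr opprK.
Qed.

End ChargedOperators.

(** * The Cayley transform between the split and the diagonal form *)

Section Conjugation.
Variable R : realType.
Local Notation C := R[i].

(** Congruence by [S] carries the expression that measures the failure of [N] to be skew for [H] to
    [c] times the one for [M] and [H'], and conjugation keeps the trace. *)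
Lemma special_unitary_conj n (H H' S M : 'M[C]_n) (c : C) :
  S \in unitmx -> c != 0 -> adjmx S *m H *m S = c *: H' ->
  special_unitary H (S *m M *m invmx S) <-> special_unitary H' M.
Proof.
move=> Su c0 SH; set N := S *m M *m invmx S.
have NS : N *m S = S *m M by rewrite /N mulmxKV.
have Sau : adjmx S \in unitmx by rewrite /adjmx unitmx_tr map_unitmx.
have key : adjmx S *m (adjmx N *m H + H *m N) *m S =
           c *: (adjmx M *m H' + H' *m M).
  have eN : adjmx S *m (adjmx N *m H) *m S = adjmx M *m (adjmx S *m H *m S).
    by rewrite !mulmxA -adjmxM NS adjmxM.
  have eN' : adjmx S *m (H *m N) *m S = adjmx S *m H *m S *m M.
    by rewrite -[RHS]mulmxA -NS !mulmxA.
  rewrite mulmxDr mulmxDl eN eN' SH.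
  by rewrite -scalemxAr -scalemxAl scalerDr.
have -> : special_unitary H N = (adjmx N *m H + H *m N = 0 /\ \tr N = 0) by [].
rewrite (_ : \tr N = \tr M); last by rewrite /N mxtrace_mulC mulKmx.
split=> -[h t]; split=> //.
  by apply: (scalerI c0); rewrite -key h mulmx0 mul0mx scaler0.
move: key; rewrite h scaler0.
by move=> /(canRL (mulmxK Su)); rewrite mul0mx => /(canRL (mulKmx Sau)); rewrite mulmx0.
Qed.

Variable m : nat.

Definition cayley : 'M[C]_(m + m) :=
  block_mx 1%:M 'i%:M 1%:M (- 'i%:M).

Lemma cayley_unit : cayley \in unitmx.
Proof.
pose T : 'M[C]_(m + m) := 2^-1 *: block_mx 1%:M 1%:M (- 'i%:M) 'i%:M.
suff /mulmx1_unit[] : cayley *m T = 1%:M by [].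
rewrite /T -scalemxAr /cayley mulmx_block.
rewrite !(mulmx1, mul1mx, mulmxN, mulNmx) -!scalar_mxM -expr2 sqrCi.
rewrite !rmorphN1 !opprK !(subrr, addNr) -!mulr2n.
rewrite scale_block_mx !scaler0 -(scaler_nat 2 1%:M) scalerA mulVf ?pnatr_eq0 //.
by rewrite scale1r -scalar_mx_block.
Qed.

(** The diagonal form is Hermitian and [split_form] skew-Hermitian, so a congruence can match them
    only up to an imaginary factor. *)
Lemma cayley_form :
  adjmx cayley *m block_mx 1%:M 0 0 (- 1%:M) *m cayley =
  ('i *+ 2) *: split_form R m.
Proof.
have adjmx_scalar n (a : C) : adjmx (a%:M : 'M[C]_n) = (Num.conj a)%:M.
  by rewrite /adjmx map_scalar_mx tr_scalar_mx.
have adjmx_i : adjmx ('i%:M : 'M[C]_m) = - 'i%:M.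
  by rewrite adjmx_scalar conjCi; exact: raddfN.
rewrite /adjmx /cayley map_block_mx tr_block_mx -!/(adjmx _).
rewrite adjmxN adjmx_i adjmx_scalar rmorph1 opprK.
rewrite [X in X *m _]mulmx_block !mulmx0 !mulmxN !mulmx1 !addr0 !add0r.
rewrite mulmx_block !mulmx1 !mulmxN !mulNmx !mul1mx opprK.
rewrite !subrr -[- _ - _]opprD.
rewrite /split_form scale_block_mx !scaler0 scalerN.
by rewrite -!mulr2n -scalerMnl scalemx1.
Qed.

Lemma split_su_isomorphic (V : lmodType C) (br : V -> V -> V)
    (q : {linear 'M[C]_(m + m) -> V}) :
  injective q -> {morph q : x y / mx_bracket x y >-> br x y} ->
  real_lie_isomorphic br (@mx_bracket R (m + m))
    (q @` special_unitary (split_form R m)) (@su R m m).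
Proof.
move=> q_inj q_br.
have i2 : 'i *+ 2 != 0 :> C by rewrite mulrn_eq0 /= neq0Ci.
have su_conj M := special_unitary_conj M cayley_unit i2 cayley_form.
(* [r] inverts [q] on its image; the default [0] is taken only off the image, where an isomorphism
   of the subalgebras is unconstrained. *)
pose r x := xget 0 [set M | q M = x].
have qK M : r (q M) = M by rewrite /r; case: xgetP => [N _ /q_inj|/(_ M)/(_ erefl)].
exists (fun x => cayley *m r x *m invmx cayley); split.
- split.
  + by move=> _ [M HM <-]; rewrite qK; exact: (su_conj M).2.
  + move=> _ _ /set_mem[M _ <-] /set_mem[N _ <-]; rewrite !qK.
    by move=> /(can_inj (mulmxKV cayley_unit)) /(can_inj (mulKmx cayley_unit)) ->.
  + move=> M HM; pose N := invmx cayley *m M *m cayley.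
    have eM : M = cayley *m N *m invmx cayley.
      by rewrite /N !mulmxA mulmxV ?mul1mx ?mulmxK ?cayley_unit.
    exists (q N); last by rewrite qK.
    by exists N; [apply: (su_conj N).1; rewrite -eM; exact: HM|].
- move=> _ _ [M _ <-] [N _ <-].
  by rewrite -raddfD !qK mulmxDr mulmxDl.
- move=> a _ [M _ <-].
  by rewrite -linearZ !qK -scalemxAr -scalemxAl.
- move=> _ _ [M _ <-] [N _ <-].
  rewrite -q_br !qK /mx_bracket mulmxBr mulmxBl.
  by congr (_ - _); rewrite !mulmxA mulmxKV ?cayley_unit.
Qed.

End Conjugation.

(** * Operators on the exterior algebra *)

Section ExteriorOperators.
Variables (R : realType) (n : nat).
Local Notation C := R[i].
Implicit Types (x y : 'I_n) (I J K : {set 'I_n}) (al be : ext R n).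

(** The sign of moving [dx_x] past the factors of [dx_K] that precede it. *)
Definition sign_before x K : C := (-1) ^+ (\sum_(y in K) (y < x)).

Lemma extZE (a : C) al K : (a *: al) K = a * (al K : C).
Proof. by rewrite ffunE. Qed.

Lemma sign_sqr x K : sign_before x K * sign_before x K = 1.
Proof. by rewrite -expr2 sqrr_sign. Qed.

Lemma sign_beforeU1 x y K : y \notin K ->
  sign_before x (y |: K)%SET = (-1) ^+ (y < x)%N * sign_before x K.
Proof. by move=> yK; rewrite /sign_before big_setU1 // exprD. Qed.

Lemma sign_beforeD1 x y K : y \in K ->
  sign_before x (K :\ y)%SET = (-1) ^+ (y < x)%N * sign_before x K.
Proof.
move=> yK; rewrite -{2}(finset.setD1K yK) sign_beforeU1 ?setD11 //.
by rewrite mulrA -expr2 sqrr_sign mul1r.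
Qed.

Lemma sign_before_self x K : x \in K ->
  sign_before x (K :\ x)%SET = sign_before x K.
Proof. by move=> xK; rewrite sign_beforeD1 // ltnn mul1r. Qed.

(** This is the source of the anticommutation relations: of the two orders of treating [x] and [y],
    exactly one costs a sign. *)
Lemma sign_flip x y : x != y ->
  (-1) ^+ (x < y)%N + (-1) ^+ (y < x)%N = 0 :> C.
Proof.
by rewrite neq_ltn => /orP[] h; rewrite h ltnNge ltnW //= ?expr0 ?expr1 ?addNr ?subrr.
Qed.

Definition wedge_dx x al : ext R n :=
  [ffun K : {set 'I_n} => if x \in K then sign_before x K * (al (K :\ x)%SET : C) else 0].
Definition contract_dx x al : ext R n :=
  [ffun K : {set 'I_n} => if x \in K then 0 else sign_before x K * (al (x |: K)%SET : C)].

Lemma wedge_dx_is_linear x : linear (wedge_dx x).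
Proof.
move=> a al be; apply/ffunP => K; rewrite !ffunE.
case: ifP => _; last by rewrite scaler0 addr0.
by rewrite mulrDr -[a *: _]/(a * _) -[a *: _ in RHS]/(a * _) mulrCA.
Qed.

Lemma contract_dx_is_linear x : linear (contract_dx x).
Proof.
move=> a al be; apply/ffunP => K; rewrite !ffunE.
case: ifP => _; first by rewrite scaler0 addr0.
by rewrite mulrDr -[a *: _]/(a * _) -[a *: _ in RHS]/(a * _) mulrCA.
Qed.

HB.instance Definition _ x :=
  GRing.isLinear.Build C (ext R n) (ext R n) *:%R (wedge_dx x)
    (wedge_dx_is_linear x).
HB.instance Definition _ x :=
  GRing.isLinear.Build C (ext R n) (ext R n) *:%R (contract_dx x)
    (contract_dx_is_linear x).

Lemma wedge_dx_anti x y al :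
  wedge_dx x (wedge_dx y al) + wedge_dx y (wedge_dx x al) = 0.
Proof.
apply/ffunP => K; rewrite !ffunE !in_setD1.
have [->|xy] := eqVneq x y; first by rewrite ?eqxx /= mulr0 !if_same addr0.
rewrite /=.
have [xK|xK] := boolP (x \in K); have [yK|yK] := boolP (y \in K); rewrite ?mulr0 ?addr0 //.
rewrite !sign_beforeD1 // (finset.setDDl _ [set x]) finset.setUC -finset.setDDl.
rewrite !mulrA -mulrDl; set s := (X in X * _); suff -> : s = 0 by rewrite mul0r.
transitivity (sign_before x K * sign_before y K *
   ((-1) ^+ (x < y)%N + (-1) ^+ (y < x)%N)); first by rewrite /s; ring.
by rewrite sign_flip // mulr0.
Qed.

Lemma contract_dx_anti x y al :
  contract_dx x (contract_dx y al) + contract_dx y (contract_dx x al) = 0.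
Proof.
apply/ffunP => K; rewrite !ffunE !in_setU1.
have [->|xy] := eqVneq x y; first by rewrite ?eqxx /= mulr0 !if_same addr0.
rewrite /=.
have [xK|xK] := boolP (x \in K); have [yK|yK] := boolP (y \in K); rewrite ?mulr0 ?addr0 //.
rewrite !sign_beforeU1 // finset.setUCA.
rewrite !mulrA -mulrDl; set s := (X in X * _); suff -> : s = 0 by rewrite mul0r.
transitivity (sign_before x K * sign_before y K *
   ((-1) ^+ (x < y)%N + (-1) ^+ (y < x)%N)); first by rewrite /s; ring.
by rewrite sign_flip // mulr0.
Qed.

(** For [x = y] exactly one of the terms survives at each [K], the first if [x] is in [K] and the
    second if not; for distinct indices the terms cancel by [sign_flip]. *)
Lemma wedge_contract_dx x y al :
  wedge_dx x (contract_dx y al) + contract_dx y (wedge_dx x al) = (x == y)%:R *: al.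
Proof.
apply/ffunP => K; rewrite extZE !ffunE !in_setD1 !in_setU1.
have [->|xy] := eqVneq x y.
  rewrite /=; have [yK|yK] := boolP (y \in K).
    by rewrite sign_beforeD1 // ltnn !mul1r finset.setD1K // mulrA sign_sqr addr0 mul1r.
  by rewrite add0r sign_beforeU1 // ltnn !mul1r finset.setU1K // mulrA sign_sqr mul1r.
rewrite mul0r /=.
have [xK|xK] := boolP (x \in K); have [yK|yK] := boolP (y \in K); rewrite ?mulr0 ?addr0 //.
rewrite sign_beforeD1 // sign_beforeU1 //.
have -> : ((y |: K) :\ x = y |: K :\ x)%SET.
  by apply/setP => z; rewrite !inE; have [->|] := eqVneq z y; rewrite // eq_sym xy.
rewrite !mulrA -mulrDl; set s := (X in X * _); suff -> : s = 0 by rewrite mul0r.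
transitivity (sign_before x K * sign_before y K *
   ((-1) ^+ (x < y)%N + (-1) ^+ (y < x)%N)); first by rewrite /s; ring.
by rewrite sign_flip // mulr0.
Qed.

(** * Signs of wedge products, and associativity for a covector on the left *)

Definition sign_after x K : C := (-1) ^+ (\sum_(y in K) (x < y)).

Lemma sign_before_after x K : x \notin K ->
  sign_before x K * sign_after x K = (-1) ^+ #|K|.
Proof.
move=> xK; rewrite -exprD -big_split /= -sum1_card.
congr (_ ^+ _); apply: eq_bigr => y yK.
have : y != x by apply: contraNneq xK => <-.
by rewrite neq_ltn => /orP[] h; rewrite h ltnNge ltnW.
Qed.

(** Counting the inversions by their first entry makes the sign multiplicative in [I]. *)
Lemma wedge_signE I J : wedge_sign R I J = \prod_(a in I) sign_before a J.
Proof.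
rewrite /wedge_sign /sign_before prodrXr; congr (_ ^+ _).
rewrite -sum1_card pair_big_dep /= big_mkcond [RHS]big_mkcond.
by apply: eq_bigr => -[a b] _; rewrite inE /=; case: (a \in I); case: (b \in J) => //=; case: ltnP.
Qed.

Lemma wedge_signU1l x I J : x \notin I ->
  wedge_sign R (x |: I)%SET J = sign_before x J * wedge_sign R I J.
Proof. by move=> xI; rewrite !wedge_signE big_setU1. Qed.

Lemma wedge_signU1r x I J : x \notin J ->
  wedge_sign R I (x |: J)%SET = sign_after x I * wedge_sign R I J.
Proof.
move=> xJ; rewrite !wedge_signE /sign_after -prodrXr -big_split /=.
by apply: eq_bigr => a aI; rewrite sign_beforeU1.
Qed.

Lemma wedge_sign0l J : wedge_sign R finset.set0 J = 1.
Proof. by rewrite wedge_signE big_set0. Qed.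

Lemma wedge_one_form (u : 'rV[R]_n) al :
  wedge (one_form u) al = \sum_x (u 0 x)%:C%C *: wedge_dx x al.
Proof.
apply/ffunP => K; rewrite ffunE sum_ffunE.
under eq_bigr => I _ do rewrite ffunE mulr_sumr mulr_suml.
rewrite exchange_big /=; apply: eq_bigr => x _; rewrite extZE ffunE.
have [xK|xK] := boolP (x \in K).
  rewrite (bigD1 [set x]%SET) ?finset.sub1set //= eqxx.
  rewrite big1 => [|I /andP[_ Ix]].
    rewrite addr0 -{1}[[set x]%SET]finset.setU0 wedge_signU1l ?inE //.
    rewrite wedge_sign0l mulr1 sign_beforeD1 // ltnn mul1r.
    by rewrite mulrAC mulrC mulrA.
  by rewrite (negPf Ix) mulr0 mul0r.
rewrite big1 ?mulr0 // => I IK; case: eqP => [eI|_]; last by rewrite mulr0 mul0r.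
by move: IK; rewrite eI finset.sub1set (negPf xK).
Qed.

(** The subsets of [K] that contain [x] correspond to the subsets [I] of [K :\ x], and
    [sign_before x] is multiplicative over the splitting of [K :\ x] into [I] and its complement. *)
Lemma wedge_dx_assoc x al be : wedge (wedge_dx x al) be = wedge_dx x (wedge al be).
Proof.
apply/ffunP => K; rewrite !ffunE.
have [xK|xK] := boolP (x \in K); last first.
  rewrite big1 // => I IK; rewrite ffunE ifF ?mulr0 ?mul0r //.
  by apply: contraNF xK; move/(fintype.subsetP IK).
rewrite mulr_sumr (bigID (fun I : {set 'I_n} => x \in I)) /= addrC.
rewrite big1 ?add0r => [|I /andP[_ xI]]; last first.
  by rewrite ffunE (negPf xI) mulr0 mul0r.
rewrite (reindex_onto (fun I => x |: I)%SET (fun I => I :\ x)%SET) /=; last first.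
  by move=> I /andP[_ xI]; rewrite finset.setD1K.
apply: eq_big => [I|I /andP[/andP[IK _] /eqP xI]].
  rewrite setU11 andbT finset.subUset finset.sub1set xK /= subsetD1; congr (_ && _).
  apply/eqP/idP => [<-|xI]; first by rewrite setD11.
  by rewrite finset.setU1K.
have {}xI : x \notin I by rewrite -xI setD11.
have eK : (K :\: (x |: I) = K :\ x :\: I)%SET by rewrite finset.setDDl.
rewrite ffunE setU11 finset.setU1K // eK wedge_signU1l // sign_beforeU1 // ltnn mul1r.
have -> : sign_before x K = sign_before x I * sign_before x (K :\ x :\: I)%SET.
  rewrite -sign_before_self //.
  rewrite /sign_before -exprD; congr (_ ^+ _).
  rewrite (big_setID I) /=; congr (_ + _)%N; apply: eq_bigl => y.
  rewrite !inE; have [yI|] := boolP (y \in I); last by rewrite andbF.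
  rewrite andbT; have [yx|_ /=] := eqVneq y x; first by rewrite -yx yI in xI.
  by rewrite (fintype.subsetP IK) // setU1r.
by ring.
Qed.

Lemma wedge_sum_l (T : Type) (r : seq T) (F : T -> ext R n) be :
  wedge (\sum_(i <- r) F i) be = \sum_(i <- r) wedge (F i) be.
Proof.
elim: r => [|i r IH].
  rewrite !big_nil; apply/ffunP => K; rewrite !ffunE big1 // => I _.
  by rewrite ffunE mulr0 mul0r.
rewrite !big_cons -IH; apply/ffunP => K; rewrite !ffunE -big_split /=.
by apply: eq_bigr => I _; rewrite ffunE mulrDr mulrDl.
Qed.

Lemma wedgeZl (c : C) al be : wedge (c *: al) be = c *: wedge al be.
Proof.
apply/ffunP => K; rewrite !ffunE scaler_sumr; apply: eq_bigr => I _.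
by rewrite extZE mulrCA -!mulrA.
Qed.

Lemma wedge_one_form_assoc (u : 'rV[R]_n) al be :
  wedge (wedge (one_form u) al) be = wedge (one_form u) (wedge al be).
Proof.
rewrite !wedge_one_form wedge_sum_l; apply: eq_bigr => x _.
by rewrite wedgeZl wedge_dx_assoc.
Qed.

Lemma wedge_one_form_degree (u : 'rV[R]_n) al d :
  (forall K, #|K| != d -> al K = 0) ->
  forall K, #|K| != d.+1 -> wedge (one_form u) al K = 0.
Proof.
move=> al0 K Kd; rewrite wedge_one_form sum_ffunE big1 // => x _.
rewrite extZE ffunE; case: ifP => xK; last by rewrite mulr0.
rewrite al0 ?mulr0 //; apply: contraNneq Kd => <-.
by rewrite (cardsD1 x K) xK.
Qed.

End ExteriorOperators.

(** * The Hermitian product of forms *)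

Section HermitianForm.
Variables (R : realType) (n : nat).
Local Notation C := R[i].
Implicit Types (a x y : 'I_n) (I J K : {set 'I_n}) (al be : ext R n).

(** The interior product with the tangent vector of components [w]. *)
Definition contract (w : 'rV[R]_n) al : ext R n :=
  \sum_y (w 0 y)%:C%C *: contract_dx y al.

Lemma contract_is_linear w : linear (contract w).
Proof.
move=> c al be; rewrite /contract scaler_sumr -big_split /=.
by apply: eq_bigr => y _; rewrite linearP /= scalerDr !scalerA mulrC.
Qed.

HB.instance Definition _ w :=
  GRing.isLinear.Build C (ext R n) (ext R n) *:%R (contract w)
    (contract_is_linear w).

Lemma contract_anti w w' al :
  contract w (contract w' al) + contract w' (contract w al) = 0.
Proof.
rewrite /contract.
under eq_bigr do rewrite linear_sum scaler_sumr.
under [X in _ + X]eq_bigr do rewrite linear_sum scaler_sumr.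
rewrite [X in _ + X]exchange_big -big_split /= big1 // => x _.
rewrite -big_split /= big1 // => y _.
rewrite !linearZ /= !scalerA [X in _ + X *: _]mulrC -scalerDr.
by rewrite contract_dx_anti scaler0.
Qed.

Lemma contract_sqr w al : contract w (contract w al) = 0.
Proof.
apply: (scalerI (a := 2 : C)); first by rewrite pnatr_eq0.
by rewrite scaler0 scaler_nat mulr2n contract_anti.
Qed.

Variable G : 'M[R]_n.

(* By Laplace expansion along the rows, the product of [dx_I] with [be] is read
   off the constant term of [contract_seq (enum I) be]. *)
Fixpoint contract_seq (xs : seq 'I_n) al : ext R n :=
  if xs is a :: xs' then contract_seq xs' (contract (row a G) al) else al.

Lemma contract_seq_is_linear xs : linear (contract_seq xs).
Proof. by elim: xs => [|a xs IH] c al be //=; rewrite linearP IH. Qed.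

HB.instance Definition _ xs :=
  GRing.isLinear.Build C (ext R n) (ext R n) *:%R (contract_seq xs)
    (contract_seq_is_linear xs).

Definition dx I : ext R n := [ffun K : {set 'I_n} => (K == I)%:R].

Lemma ext_dx al : al = \sum_I (al I : C) *: dx I.
Proof.
apply/ffunP => K; rewrite sum_ffunE (bigD1 K) //= big1 => [|I IK].
  by rewrite extZE ffunE eqxx mulr1 addr0.
by rewrite extZE ffunE eq_sym (negPf IK) mulr0.
Qed.

Lemma contract_dx_dx y J :
  contract_dx y (dx J) =
  if y \in J then sign_before R y J *: dx (J :\ y)%SET else 0.
Proof.
apply/ffunP => K; rewrite !ffunE.
have [yK|yK] := boolP (y \in K).
  case: ifP => yJ; rewrite !ffunE // (_ : (K == _) = false) ?scaler0 //.
  by apply/eqP => eK; rewrite eK setD11 in yK.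
case: ifP => yJ; rewrite !ffunE.
  rewrite -(sign_before_self _ yJ).
  have [->|neK] := eqVneq K (J :\ y)%SET; first by rewrite finset.setD1K // eqxx.
  rewrite (_ : (_ == J) = false) ?mulr0 ?scaler0 //.
  by apply/eqP => eJ; rewrite -eJ finset.setU1K ?eqxx in neK.
rewrite (_ : (_ == J) = false) ?mulr0 //.
by apply/eqP => eJ; rewrite -eJ setU11 in yJ.
Qed.

Lemma sorted_enum_set J : sorted ltn [seq val i | i <- enum J].
Proof.
rewrite sorted_map; apply: sorted_filter; first by move=> x y z; apply: ltn_trans.
by rewrite -enumT -sorted_map val_enum_ord iota_ltn_sorted.
Qed.

Lemma count_lt_nth_sorted (s : seq nat) (j : nat) : sorted ltn s -> (j < size s)%N ->
  count (fun i => i < nth 0 s j)%N s = j.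
Proof.
elim: s j => [|x s IH] [|j] //= xs js.
  rewrite ltnn add0n; apply/eqP; rewrite -leqn0 leqNgt -has_count; apply/hasPn => y ys.
  by rewrite -leqNgt ltnW // (allP (order_path_min ltn_trans xs)).
rewrite IH ?(path_sorted xs) // (allP (order_path_min ltn_trans xs)) ?mem_nth //.
Qed.

(** This matches the sign of a contraction with the cofactor sign in a Laplace expansion. *)
Lemma sign_before_nth x0 J (j : nat) : (j < #|J|)%N ->
  sign_before R (nth x0 (enum J) j) J = (-1) ^+ j.
Proof.
rewrite cardE => jJ; rewrite /sign_before; congr (_ ^+ _).
rewrite -big_enum /= -[RHS](count_lt_nth_sorted (sorted_enum_set J) (j := j)) ?size_map //.
rewrite (nth_map x0) // count_map -sum1_count [RHS]big_mkcond.
by apply: eq_bigr => y _; rewrite /=; case: ifP.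
Qed.

Lemma enum_setD1_nth x0 J (j : nat) : (j < #|J|)%N ->
  enum (J :\ nth x0 (enum J) j)%SET = take j (enum J) ++ drop j.+1 (enum J).
Proof.
rewrite cardE => jJ; set b := nth _ _ _.
have -> : enum (J :\ b)%SET = rem b (enum J).
  rewrite rem_filter ?enum_uniq // /enum_mem -filter_predI.
  by apply: eq_filter => z; rewrite /= !inE.
by rewrite remE index_uniq ?enum_uniq.
Qed.

Lemma map_enum_val I : [seq enum_val i | i <- enum 'I_#|I|] = enum I.
Proof.
have [I0|[x0 _]] := set_0Vmem I.
  rewrite [RHS](_ : _ = [::]) ?I0 ?enum_set0 //.
  by apply: size0nil; rewrite size_map size_enum_ord cards0.
apply: (@eq_from_nth _ x0); first by rewrite size_map size_enum_ord cardE.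
move=> i; rewrite size_map size_enum_ord => iI.
rewrite (nth_map (Ordinal iI)) ?size_enum_ord // (enum_val_nth x0).
by rewrite (nth_ord_enum (Ordinal iI) (Ordinal iI)).
Qed.

Lemma det_contract_seq k (f : 'I_k -> 'I_n) J : #|J| = k ->
  (\det (\matrix_(i < k, j < k) G (f i) (nth (f i) (enum J) j)))%:C%C =
  contract_seq [seq f i | i <- enum 'I_k] (dx J) finset.set0 :> C.
Proof.
elim: k f J => [|k IH] f J Jk.
  rewrite det_mx00 (cards0_eq Jk) enum_ord0 /= ffunE eqxx.
  exact: rmorph1.
rewrite (expand_det_row _ ord0) rmorph_sum /= enum_ordSl /=.
rewrite {1}/contract linear_sum sum_ffunE.
rewrite (bigID (fun y => y \in J)) /= [X in _ = _ + X]big1 ?addr0 => [|y yJ]; last first.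
  by rewrite contract_dx_dx (negPf yJ) scaler0 linear0 ffunE.
rewrite -[in RHS]big_enum /= (big_nth (f ord0)) -cardE Jk big_mkord.
apply: eq_bigr => j _; set b := nth (f ord0) (enum J) j.
have bJ : b \in J by rewrite -mem_enum mem_nth // -cardE Jk.
have JbK : #|(J :\ b)%SET| = k.
  by apply/eqP; rewrite -eqSS -Jk (cardsD1 b J) bJ.
rewrite contract_dx_dx bJ !linearZ /= !extZE mxE [row _ _ _ _]mxE rmorphM /=.
congr (_ * _).
rewrite /b sign_before_nth ?Jk // rmorphM rmorphXn rmorphN1 add0n; congr (_ * _).
rewrite -map_comp -/b -(IH (f \o lift ord0)) //; congr (\det _)%:C%C.
apply/matrixP => i i'; rewrite !mxE /comp; congr (G _ _).
move: (f (lift ord0 i)) => y0.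
(* Deleting [b] from [J] deletes column [j]: beyond that position the enumeration shifts by one, as
   [lift j] does. *)
rewrite enum_setD1_nth ?Jk // nth_cat size_take -cardE Jk ltn_ord.
rewrite /lift /= /bump; case: ltnP => h; first by rewrite nth_take // leqNgt h.
by rewrite nth_drop add1n addSn subnKC.
Qed.

Lemma contract_seq_degree xs al k :
  (forall I, #|I| = (k + size xs)%N -> al I = 0) ->
  forall K, #|K| = k -> contract_seq xs al K = 0.
Proof.
elim: xs al => [|a xs IH] al h K Kk /=; first by apply: h; rewrite addn0.
apply: (IH _ _ K Kk) => I Ik; rewrite /contract sum_ffunE big1 // => y _.
rewrite extZE ffunE; case: ifP => yI; first by rewrite mulr0.
by rewrite h ?mulr0 // cardsU1 yI Ik addnS.
Qed.

(** Iterated contractions replace the minors, so that adjoints can be computed by reordering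
    contractions. The sets [J] of another size than [I] contribute nothing, each contraction
    lowering the degree by one. *)
Lemma hermE al be : herm G al be =
  \sum_I (al I : C) * (contract_seq (enum I) be finset.set0 : C)^*.
Proof.
rewrite /herm; apply: eq_bigr => I _.
rewrite {2}[be]ext_dx linear_sum sum_ffunE rmorph_sum mulr_sumr /=.
rewrite [RHS](bigID (fun J : {set 'I_n} => #|J| == #|I|)) /=.
rewrite [X in _ = _ + X]big1 ?addr0 => [|J JI]; last first.
  rewrite linearZ extZE (contract_seq_degree (k := 0)) ?mulr0 ?rmorph0 ?mulr0 ?cards0 //.
  move=> K; rewrite add0n -cardE => KI; rewrite ffunE.
  by case: eqP => // KJ; rewrite -KJ KI eqxx in JI.
apply: eq_bigr => J /eqP JI; rewrite linearZ extZE rmorphM /=.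
suff -> : contract_seq (enum I) (dx J) finset.set0 = (minor G I J)%:C%C.
  by rewrite conjC_real; ring.
rewrite /minor (det_contract_seq _ JI); congr (contract_seq _ _ _).
by rewrite map_enum_val.
Qed.

Lemma sorted_set_enum (xs : seq 'I_n) K :
  sorted ltn [seq val i | i <- xs] -> xs =i K -> xs = enum K.
Proof.
move=> sxs xsK; apply: (inj_map val_inj).
apply: (irr_sorted_eq ltn_trans ltnn) => //; first exact: sorted_enum_set.
move=> i; apply/mapP/mapP => -[z zs ->]; exists z => //.
  by rewrite mem_enum -xsK.
by rewrite xsK -mem_enum.
Qed.

(** The contraction with index [a] is moved to its sorted place; each exchange costs a sign, and
    meeting a second copy of [a] gives zero. *)
Lemma contract_seq_insert a xs al : sorted ltn [seq val i | i <- xs] ->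
  if a \in xs then contract_seq (a :: xs) al = 0 else
  exists2 ys, sorted ltn [seq val i | i <- ys] /\ ys =i a :: xs &
    contract_seq (a :: xs) al =
      (-1) ^+ (\sum_(y <- xs) (y < a)) *: contract_seq ys al.
Proof.
elim: xs al => [|x xs IH] al sxs /=.
  by exists [:: a] => //; rewrite big_nil scale1r.
have [->|ax] := eqVneq a x.
  by rewrite mem_head contract_sqr linear0.
rewrite in_cons (negPf ax) /=.
have xlt y : y \in xs -> (x < y)%N.
  move=> yxs; apply: (allP (order_path_min ltn_trans sxs)).
  exact: map_f.
have swap : contract (row x G) (contract (row a G) al) =
            - contract (row a G) (contract (row x G) al).
  by apply/eqP; rewrite -addr_eq0 contract_anti.
case: ifP => axs.
  rewrite swap linearN /=; have := IH (contract (row x G) al) (path_sorted sxs).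
  by rewrite axs /= => ->; rewrite oppr0.
have [xa|xa] := ltnP x a; last first.
  have {}xa : (a < x)%N by rewrite ltn_neqAle xa andbT.
  exists (a :: x :: xs); first by split=> //=; rewrite xa.
  rewrite big_cons ltnNge ltnW //= big_seq big1 ?scale1r // => y /xlt xy.
  by rewrite ltnNge (ltnW (ltn_trans xa xy)).
have := IH (contract (row x G) al) (path_sorted sxs); rewrite axs.
case=> ys [sys mys] /= eys; exists (x :: ys).
  split=> [/=|z]; last by rewrite !in_cons mys in_cons orbCA.
  rewrite path_min_sorted //; apply/allP => _ /mapP[z zys ->].
  by move: zys; rewrite mys in_cons => /orP[/eqP->|/xlt].
by rewrite swap linearN /= eys big_cons xa /= exprS mulN1r scaleNr.
Qed.

(** Both sides reduce to the sets [I] without [a], and sorting [a] into [I] costs the same sign for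
    the wedge product as for the contractions. *)
Lemma herm_wedge_dx a al be :
  herm G (wedge_dx a al) be = herm G al (contract (row a G) be).
Proof.
rewrite !hermE (bigID (fun I : {set 'I_n} => a \in I)) /= addrC big1 ?add0r => [|I aI]; last first.
  by rewrite ffunE (negPf aI) mul0r.
rewrite [RHS](bigID (fun I : {set 'I_n} => a \in I)) /=.
rewrite [X in _ = X + _]big1 ?add0r => [|I aI]; last first.
  have := contract_seq_insert a be (sorted_enum_set I).
  by rewrite mem_enum aI /= => ->; rewrite ffunE rmorph0 mulr0.
rewrite (reindex_onto (fun I => a |: I)%SET (fun I => I :\ a)%SET) /=; last first.
  by move=> I aI; rewrite finset.setD1K.
apply: eq_big => [I|I /andP[_ /eqP eI]].
  rewrite setU11 /=; apply/eqP/idP => [<-|aI]; first by rewrite setD11.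
  by rewrite finset.setU1K.
have aI : a \notin I by rewrite -eI setD11.
rewrite ffunE setU11 eI sign_beforeU1 // ltnn mul1r mulrAC mulrC; congr (_ * _).
have := contract_seq_insert a be (sorted_enum_set I).
rewrite mem_enum (negPf aI) => -[ys [sys mys] /= ->].
rewrite (sorted_set_enum (K := (a |: I)%SET) sys) => [|z]; last first.
  by rewrite mys in_cons mem_enum in_setU1.
rewrite extZE rmorphM /= big_enum /= rmorphXn rmorphN1.
by rewrite mulrC.
Qed.

Lemma hermDl al al' be : herm G (al + al') be = herm G al be + herm G al' be.
Proof.
by rewrite !hermE -big_split /=; apply: eq_bigr => I _; rewrite ffunE mulrDl.
Qed.

Lemma hermZl (c : C) al be : herm G (c *: al) be = c * herm G al be.
Proof. by rewrite !hermE mulr_sumr; apply: eq_bigr => I _; rewrite extZE mulrA. Qed.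

Lemma hermDr al be be' : herm G al (be + be') = herm G al be + herm G al be'.
Proof.
rewrite !hermE -big_split /=; apply: eq_bigr => I _.
by rewrite linearD ffunE rmorphD mulrDr.
Qed.

Lemma hermZr (c : C) al be : herm G al (c *: be) = c^* * herm G al be.
Proof.
rewrite !hermE mulr_sumr; apply: eq_bigr => I _.
by rewrite linearZ extZE rmorphM mulrCA.
Qed.

Lemma herm0l be : herm G 0 be = 0.
Proof. by rewrite -[0 as X in herm G X _](scale0r 0) hermZl mul0r. Qed.

Lemma herm0r al : herm G al 0 = 0.
Proof. by rewrite -[X in herm G _ X](scale0r 0) hermZr rmorph0 mul0r. Qed.

Lemma herm_suml (T : Type) (r : seq T) (P : pred T)
    (F : T -> ext R n) be :
  herm G (\sum_(i <- r | P i) F i) be = \sum_(i <- r | P i) herm G (F i) be.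
Proof. by elim/big_rec2: _ => [|i x y _ <-]; rewrite ?herm0l ?hermDl. Qed.

Lemma herm_sumr (T : Type) (r : seq T) (P : pred T)
    (F : T -> ext R n) al :
  herm G al (\sum_(i <- r | P i) F i) = \sum_(i <- r | P i) herm G al (F i).
Proof. by elim/big_rec2: _ => [|i x y _ <-]; rewrite ?herm0r ?hermDr. Qed.

Lemma contract_mulmx (u : 'rV[R]_n) al :
  contract (u *m G) al = \sum_x (u 0 x)%:C%C *: contract (row x G) al.
Proof.
rewrite /contract; under [RHS]eq_bigr do rewrite scaler_sumr.
rewrite exchange_big /=; apply: eq_bigr => y _.
rewrite mxE rmorph_sum /= scaler_suml; apply: eq_bigr => x _.
by rewrite mxE rmorphM /= scalerA.
Qed.

Lemma herm_wedge_one_form (u : 'rV[R]_n) al be :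
  herm G (wedge (one_form u) al) be = herm G al (contract (u *m G) be).
Proof.
rewrite wedge_one_form contract_mulmx herm_suml herm_sumr.
by apply: eq_bigr => x _; rewrite hermZl hermZr conjC_real herm_wedge_dx.
Qed.

(** By induction on the degree: [contract_dx y] is adjoint to the wedge product with the covector
    [delta_mx 0 y *m invmx G], so it preserves the radical, and the coefficient of [be] at [K] is,
    up to sign, that of its contraction at [K :\ y]. *)
Lemma herm_nondegenerate be : G \in unitmx ->
  (forall al, herm G al be = 0) -> be = 0.
Proof.
move=> Gu; suff h k : forall be, (forall al, herm G al be = 0) ->
    forall K : {set 'I_n}, #|K| = k -> be K = 0.
  by move=> be0; apply/ffunP => K; rewrite (h _ _ be0 K erefl) ffunE.
elim: k => [|k IH] be' be0 K Kk.
  have := be0 (dx finset.set0); rewrite hermE (bigD1 finset.set0) //= big1 => [|I I0].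
    rewrite ffunE eqxx mul1r addr0 enum_set0 /= (cards0_eq Kk) => /eqP.
    by rewrite conjC_eq0 => /eqP.
  by rewrite ffunE (negPf I0) mul0r.
have [y yK] : exists y, y \in K by apply/card_gt0P; rewrite Kk.
have be1 al : herm G al (contract_dx y be') = 0.
  have -> : contract_dx y be' = contract (delta_mx 0 y *m invmx G *m G) be'.
    rewrite mulmxKV // /contract (bigD1 y) //= big1 => [|z zy].
      by rewrite addr0 mxE !eqxx scale1r.
    by rewrite mxE (negPf zy) andbF scale0r.
  by rewrite -herm_wedge_one_form be0.
have Kyk : #|(K :\ y)%SET| = k.
  by apply/eqP; rewrite -eqSS -Kk (cardsD1 y K) yK.
have /eqP := IH _ be1 _ Kyk.
by rewrite ffunE setD11 finset.setD1K // mulf_eq0 signr_eq0 => /eqP.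
Qed.

Lemma is_adjoint_unique (f f' f'' : 'End(ext R n)) : G \in unitmx ->
  is_adjoint G f f' -> is_adjoint G f f'' -> f' = f''.
Proof.
move=> Gu h' h''; apply/lfunP => be; apply/eqP; rewrite -subr_eq0; apply/eqP.
apply: herm_nondegenerate => // al.
by rewrite hermDr -scaleN1r hermZr rmorphN1 mulN1r -h' -h'' subrr.
Qed.

Lemma wedge_contract (u w : 'rV[R]_n) al :
  wedge (one_form u) (contract w al) + contract w (wedge (one_form u) al) =
  ((u *m w^T) 0 0)%:C%C *: al.
Proof.
rewrite !wedge_one_form linear_sum -big_split /= mxE rmorph_sum scaler_suml.
apply: eq_bigr => x _; rewrite linearZ -scalerDr /= mxE rmorphM -scalerA; congr (_ *: _).
rewrite /contract linear_sum -big_split (bigD1 x) //= big1 => [|y yx].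
  by rewrite addr0 linearZ -scalerDr /= wedge_contract_dx eqxx scale1r.
by rewrite linearZ -scalerDr /= wedge_contract_dx eq_sym (negPf yx) scale0r scaler0.
Qed.

Lemma wedge_one_form_anti (u w : 'rV[R]_n) al :
  wedge (one_form u) (wedge (one_form w) al) +
  wedge (one_form w) (wedge (one_form u) al) = 0.
Proof.
rewrite !wedge_one_form.
under eq_bigr do rewrite linear_sum scaler_sumr.
under [X in _ + X]eq_bigr do rewrite linear_sum scaler_sumr.
rewrite [X in _ + X]exchange_big -big_split /= big1 // => x _.
rewrite -big_split /= big1 // => y _.
rewrite !linearZ /= !scalerA [X in _ + X *: _]mulrC -scalerDr.
by rewrite wedge_dx_anti scaler0.
Qed.

End HermitianForm.

(** * The form attached to a volume form *)

Section VolumePairing.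
Variables (R : realType) (n : nat).
Local Notation C := R[i].
Implicit Types (I J K : {set 'I_n}) (al be : ext R n).
Local Notation full := ([set: 'I_n]%SET).

(* [vol_form] up to the constant factor coming from the volume form. *)
Definition pairing al be : C :=
  \sum_(I : {set 'I_n}) 'i ^+ (#|I| * #|(~: I)%SET|)%N * wedge_sign R I (~: I)%SET *
         (al I : C) * (be (~: I)%SET : C)^*.

Lemma card_full K : (#|K| == n) = (K == full).
Proof.
apply/eqP/eqP => [Kn|->]; last by rewrite cardsT card_ord.
by apply/eqP; rewrite eqEcard finset.subsetT cardsT card_ord Kn leqnn.
Qed.

Lemma herm_top (G : 'M[R]_n) al (om : ext R n) :
  (forall K, K != full -> om K = 0) ->
  herm G al om = (al full : C) * ((minor G full full)%:C%C * (om full : C)^*).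
Proof.
move=> om0; rewrite /herm (bigD1 full) //= (bigD1 full) //= !big1 => [|I IT|J /andP[_ JT]].
- by rewrite !addr0 -mulrA mulrCA.
- rewrite big1 // => J JI; rewrite om0 ?rmorph0 ?mulr0 //.
  apply: contraNneq IT => JT.
  by rewrite -card_full -(eqP JI) JT cardsT card_ord.
- by rewrite om0 // rmorph0 mulr0.
Qed.

(** For each [I], the only degrees that contribute are those of [I] and of its complement. *)
Lemma homog_homog al be :
  \sum_(a < n.+1) \sum_(b < n.+1) 'i ^+ (a * b) *
     (wedge (homog a al) (ext_conj (homog b be)) full : C) = pairing al be.
Proof.
under eq_bigr => a _ do under eq_bigr => b _ do rewrite ffunE mulr_sumr.
under eq_bigr => a _ do rewrite exchange_big /=.
rewrite exchange_big /= /pairing; apply: eq_big => [I|I _]; first exact: finset.subsetT.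
have cardn K : (#|K| < n.+1)%N by rewrite ltnS -[X in (_ <= X)%N]card_ord max_card.
rewrite (bigD1 (Ordinal (cardn I))) //= [X in _ + X]big1 => [|a aI]; last first.
  rewrite big1 // => b _; rewrite !ffunE ifF ?mulr0 ?mul0r ?mulr0 //.
  by apply: contraNF aI => /eqP e; apply/eqP/val_inj.
rewrite (bigD1 (Ordinal (cardn (~: I)%SET))) //= big1 => [|b bI]; last first.
  rewrite !ffunE finset.setTD [X in (X : C)^*](_ : _ = 0) ?rmorph0 ?mulr0 //.
  rewrite ifF //; by apply: contraNF bI => /eqP e; apply/eqP/val_inj.
by rewrite !addr0 !ffunE finset.setTD !eqxx !mulrA.
Qed.

Lemma vol_formE (G : 'M[R]_n) (om : ext R n) al be :
  (forall K, K != full -> om K = 0) ->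
  vol_form G om al be =
  pairing al be * ((minor G full full)%:C%C * (om full : C)^*).
Proof.
move=> om0; rewrite /vol_form -homog_homog mulr_suml; apply: eq_bigr => a _.
rewrite mulr_suml; apply: eq_bigr => b _.
by rewrite herm_top // !mulrA.
Qed.

(** If this minor vanished, the top form [dx R full] would lie in the radical of [herm]. *)
Lemma minor_full_neq0 (G : 'M[R]_n) : G \in unitmx -> minor G full full != 0.
Proof.
move=> Gu; apply/negP => /eqP G0.
have /ffunP/(_ full) : dx R full = 0.
  apply: (herm_nondegenerate Gu) => al; rewrite herm_top ?G0 ?rmorph0 ?mul0r ?mulr0 //.
  by move=> K KT; rewrite ffunE (negPf KT).
by rewrite !ffunE eqxx => /eqP; rewrite oner_eq0.
Qed.

(** Pairing with [dx] of the complement of [I] isolates the coefficient at [I]. *)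
Lemma pairing_nondegenerate al : (forall be, pairing al be = 0) -> al = 0.
Proof.
move=> al0; apply/ffunP => I; rewrite ffunE.
have /eqP := al0 (dx R (~: I)%SET).
rewrite /pairing (bigD1 I) //= big1 => [|J JI]; last first.
  by rewrite ffunE (inj_eq (@finset.setC_inj _)) (negPf JI) rmorph0 mulr0.
rewrite addr0 ffunE eqxx rmorph1 mulr1 !mulf_eq0 expf_eq0 (negPf (neq0Ci _)) andbF /=.
by rewrite /wedge_sign signr_eq0 => /eqP.
Qed.

Lemma pairingDl al al' be : pairing (al + al') be = pairing al be + pairing al' be.
Proof.
by rewrite /pairing -big_split /=; apply: eq_bigr => I _; rewrite ffunE mulrDr mulrDl.
Qed.

Lemma pairingDr al be be' : pairing al (be + be') = pairing al be + pairing al be'.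
Proof.
by rewrite /pairing -big_split /=; apply: eq_bigr => I _; rewrite ffunE rmorphD mulrDr.
Qed.

Lemma pairingZl (c : C) al be : pairing (c *: al) be = c * pairing al be.
Proof.
by rewrite /pairing mulr_sumr; apply: eq_bigr => I _; rewrite extZE mulrCA -!mulrA mulrCA.
Qed.

Lemma pairingZr (c : C) al be : pairing al (c *: be) = c^* * pairing al be.
Proof.
by rewrite /pairing mulr_sumr; apply: eq_bigr => I _; rewrite extZE rmorphM mulrCA.
Qed.

Lemma pairing0l be : pairing 0 be = 0.
Proof. by rewrite -[X in pairing X _](scale0r 0) pairingZl mul0r. Qed.

Lemma pairing0r al : pairing al 0 = 0.
Proof. by rewrite -[X in pairing _ X](scale0r 0) pairingZr rmorph0 mul0r. Qed.

Lemma pairing_suml (T : Type) (r : seq T) (P : pred T) (F : T -> ext R n) be :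
  pairing (\sum_(i <- r | P i) F i) be = \sum_(i <- r | P i) pairing (F i) be.
Proof. by elim/big_rec2: _ => [|i x y _ <-]; rewrite ?pairing0l ?pairingDl. Qed.

Lemma pairing_sumr (T : Type) (r : seq T) (P : pred T) (F : T -> ext R n) al :
  pairing al (\sum_(i <- r | P i) F i) = \sum_(i <- r | P i) pairing al (F i).
Proof. by elim/big_rec2: _ => [|i x y _ <-]; rewrite ?pairing0r ?pairingDr. Qed.

Let kappa : C := 'i ^+ n.-1.

(** Let [k] and [l] be the sizes of [K] and of the complement of [x |: K], so that [n.-1 = k + l].
    The exponents [(k + 1) l] and [(k + l) + k (l + 1)] of ['i] differ by [2 k] modulo 4, a factor
    [(-1) ^+ k] that accounts for the exchange of [sign_before x K] and [sign_after x K]. The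
    constant [kappa] thus does not depend on [K]. *)
Lemma pairing_coef x K : x \notin K ->
  'i ^+ (#|(x |: K)%SET| * #|(~: (x |: K))%SET|)%N *
     wedge_sign R (x |: K)%SET (~: (x |: K))%SET * sign_before R x K =
  kappa * ('i ^+ (#|K| * #|(~: K)%SET|)%N * wedge_sign R K (~: K)%SET *
     sign_before R x (~: K)%SET).
Proof.
move=> xK; set L := (~: (x |: K))%SET.
have xL : x \notin L by rewrite !inE eqxx.
have eL : (~: K = x |: L)%SET.
  by apply/setP => z; rewrite !inE negb_or; case: eqVneq => //= ->; rewrite ?(negPf xK) ?(negPf xI).
rewrite eL wedge_signU1l // wedge_signU1r // sign_beforeU1 // ltnn mul1r !cardsU1 xK xL !add1n.
rewrite /kappa; have -> : n.-1 = (#|K| + #|L|)%N.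
  have : (#|K| + #|(~: K)%SET| = n)%N by rewrite cardsC card_ord.
  by rewrite eL cardsU1 xL add1n addnS => /(congr1 predn).
have -> : sign_after R x K = (-1) ^+ #|K| * sign_before R x K.
  by rewrite -(sign_before_after R xK) mulrAC sign_sqr mul1r.
have -> : 'i ^+ (#|K|.+1 * #|L|)%N =
    'i ^+ (#|K| + #|L|)%N * 'i ^+ (#|K| * #|L|.+1)%N * (-1) ^+ #|K| :> C.
  rewrite -sqrCi -exprM -!exprD.
  have -> : (#|K| + #|L| + #|K| * #|L|.+1 + 2 * #|K| = #|K|.+1 * #|L| + 4 * #|K|)%N.
    by rewrite mulnS mulSn; ring.
  have i4 : 'i ^+ 4 = 1 :> C by rewrite (exprM _ 2 2) sqrCi sqrrN expr1n.
  by rewrite exprD [X in _ * X]exprM i4 expr1n mulr1.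
by ring.
Qed.

Lemma pairing_wedge_dx x al be :
  pairing (wedge_dx x al) be = kappa * pairing al (wedge_dx x be).
Proof.
rewrite /pairing mulr_sumr (bigID (fun I : {set 'I_n} => x \in I)) /= addrC.
rewrite big1 ?add0r => [|I xI]; last by rewrite ffunE (negPf xI) mulr0 mul0r.
rewrite [RHS](bigID (fun I : {set 'I_n} => x \in I)) /=.
rewrite [X in _ = X + _]big1 ?add0r => [|I xI]; last first.
  by rewrite [wedge_dx _ _ _]ffunE inE xI rmorph0 !mulr0.
rewrite (reindex_onto (fun I => x |: I)%SET (fun I => I :\ x)%SET) /=; last first.
  by move=> I xI; rewrite finset.setD1K.
apply: eq_big => [I|I /andP[_ /eqP eI]].
  rewrite setU11 /=; apply/eqP/idP => [<-|xI]; first by rewrite setD11.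
  by rewrite finset.setU1K.
have xI : x \notin I by rewrite -eI setD11.
have eL : (~: I :\ x = ~: (x |: I))%SET.
  by apply/setP => z; rewrite !inE negb_or.
rewrite !ffunE setU11 eI inE xI eL sign_beforeU1 // ltnn mul1r rmorphM /=.
have sr : (sign_before R x (~: I)%SET)^* = sign_before R x (~: I)%SET.
  by rewrite rmorphXn rmorphN1.
rewrite sr.
transitivity ('i ^+ (#|(x |: I)%SET| * #|(~: (x |: I))%SET|)%N *
  wedge_sign R (x |: I)%SET (~: (x |: I))%SET * sign_before R x I *
  ((al I : C) * (be (~: (x |: I))%SET : C)^*)); first by ring.
by rewrite pairing_coef //; ring.
Qed.

(** The coefficient identity of the wedge product is read backwards, after inserting
    [kappa^* * kappa = 1]; this is where the conjugate constant comes from. *)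
Lemma pairing_contract_dx x al be :
  pairing (contract_dx x al) be = kappa^* * pairing al (contract_dx x be).
Proof.
rewrite /pairing mulr_sumr (bigID (fun I : {set 'I_n} => x \in I)) /=.
rewrite big1 ?add0r => [|I xI]; last by rewrite ffunE xI mulr0 mul0r.
rewrite [RHS](bigID (fun I : {set 'I_n} => x \in I)) /=.
rewrite [X in _ = _ + X]big1 ?addr0 => [|I xI]; last first.
  by rewrite [contract_dx _ _ _]ffunE inE xI rmorph0 !mulr0.
rewrite [RHS](reindex_onto (fun I => x |: I)%SET (fun I => I :\ x)%SET) /=; last first.
  by move=> I xI; rewrite finset.setD1K.
apply: eq_big => [I|I xI].
  rewrite setU11 /=; apply/idP/eqP => [xI|<-]; last by rewrite setD11.
  by rewrite finset.setU1K.
have eL : (x |: ~: (x |: I) = ~: I)%SET.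
  by apply/setP => z; rewrite !inE negb_or; case: eqVneq => //= ->; rewrite ?(negPf xK) ?(negPf xI).
have eN : (~: (x |: I) = ~: I :\ x)%SET.
  by apply/setP => z; rewrite !inE negb_or.
have kk : kappa^* * kappa = 1.
  by rewrite /kappa rmorphXn /= conjCi -exprMn mulNr -expr2 sqrCi opprK expr1n.
have sr K : (sign_before R x K)^* = sign_before R x K.
  by rewrite rmorphXn rmorphN1.
rewrite !ffunE (negPf xI) !inE eqxx /= eL rmorphM /= sr.
set c := 'i ^+ (#|I| * _)%N * _.
have -> : c * (sign_before R x I * (al (x |: I)%SET : C)) * (be (~: I)%SET : C)^* =
    sign_before R x I * sign_before R x (~: I)%SET *
    (kappa^* * (kappa * (c * sign_before R x (~: I)%SET))) *
    ((al (x |: I)%SET : C) * (be (~: I)%SET : C)^*).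
  transitivity (kappa^* * kappa *
    (sign_before R x (~: I)%SET * sign_before R x (~: I)%SET) *
    (c * (sign_before R x I * (al (x |: I)%SET : C)) * (be (~: I)%SET : C)^*)).
    by rewrite kk sign_sqr !mul1r.
  by ring.
rewrite -(pairing_coef xI) -/c -(sign_before_self R (_ : x \in ~: I)%SET) ?inE // -eN.
set d := 'i ^+ (#|(x |: I)%SET| * _)%N * _.
transitivity (sign_before R x I * sign_before R x I * (kappa^* *
  (d * (al (x |: I)%SET : C) * (sign_before R x (~: (x |: I))%SET * (be (~: I)%SET : C)^*)))).
  by ring.
by rewrite sign_sqr mul1r.
Qed.

Lemma pairing_wedge_one_form (u : 'rV[R]_n) al be :
  pairing (wedge (one_form u) al) be = kappa * pairing al (wedge (one_form u) be).
Proof.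
rewrite !wedge_one_form pairing_suml pairing_sumr mulr_sumr.
apply: eq_bigr => x _.
by rewrite pairingZl pairingZr conjC_real pairing_wedge_dx mulrCA.
Qed.

Lemma pairing_contract (w : 'rV[R]_n) al be :
  pairing (contract w al) be = kappa^* * pairing al (contract w be).
Proof.
rewrite /contract pairing_suml pairing_sumr mulr_sumr.
apply: eq_bigr => x _.
by rewrite pairingZl pairingZr conjC_real pairing_contract_dx mulrCA.
Qed.

(** Transferring both factors reverses their order and multiplies by [c * c = -1]; anticommutation
    undoes both. *)
Lemma pairing_anticommuting (c : C) (f g : ext R n -> ext R n) : c * c = -1 ->
  (forall al be, pairing (f al) be = c * pairing al (f be)) ->
  (forall al be, pairing (g al) be = c * pairing al (g be)) ->
  (forall al, f (g al) + g (f al) = 0) ->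
  forall al be, pairing (f (g al)) be = pairing al (f (g be)).
Proof.
move=> cc hf hg fg al be; rewrite hf hg mulrA cc mulN1r.
have -> : f (g be) = (-1 : C) *: g (f be).
  by rewrite scaleN1r; apply/eqP; rewrite -addr_eq0 fg.
by rewrite pairingZr rmorphN1 mulN1r.
Qed.

Lemma kappa_sqr : odd n.-1 -> kappa * kappa = -1 /\ kappa^* * kappa^* = -1.
Proof.
move=> n1; have -> : kappa * kappa = -1.
  by rewrite /kappa -exprMn -expr2 sqrCi -signr_odd n1 expr1.
by split=> //; rewrite -rmorphM /kappa -exprMn -expr2 sqrCi -signr_odd n1 expr1 rmorphN1.
Qed.

End VolumePairing.

(** * The operators of an adapted coframe *)

Section EndAlgebra.
Variables (K : comNzRingType) (V : vectType K).
Hypothesis V_proper : (0 < dim V)%N.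

(** Composition makes the endomorphisms of a nonzero space a nontrivial algebra, in which the
    quadratic calculus applies. *)
Definition end_lalgType : lalgType K :=
  HB.pack 'End(V) (lfun_comp_nzRingType V_proper)
    (GRing.Lmodule_isLalgebra.Build K (lfun_comp_nzRingType V_proper)
       (fun k x y => comp_lfunZl k x y)).

Definition end_algType : algType K :=
  HB.pack 'End(V) end_lalgType
    (GRing.Lalgebra_isAlgebra.Build K end_lalgType
       (fun k x y => comp_lfunZr k x y)).

End EndAlgebra.

Lemma dim_proper (K : fieldType) (V : vectType K) (v : V) :
  v != 0 -> (0 < dim V)%N.
Proof.
apply: contraNT; rewrite -leqNgt leqn0 -dimvf dimv_eq0 => /eqP V0.
by rewrite -memv0 -V0 memvf.
Qed.

Section AdaptedCoframe.
Variables (R : realType) (s : nat).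
Local Notation C := R[i].
Local Notation m := s.+1.
Local Notation n := (2 * s.+1)%N.
Variables (v : coframe R s) (G : 'M[R]_n).
Hypothesis v_orthonormal : forall i j i' j',
  (v i j *m G *m (v i' j')^T) 0 0 = ((i == i') && (j == j'))%:R.

Let ext := ext R n.

(** The coframe has as many covectors as the dimension, so the matrix [P] of its rows is square, and
    [P *m G *m P^T = 1] forces [G] to be invertible. *)
Lemma gram_unit : G \in unitmx.
Proof.
pose ix (r : 'I_n) : 'I_2 * 'I_m := enum_val (cast_ord (esym (mxvec_cast 2 m)) r).
pose P : 'M[R]_n := \matrix_r v (ix r).1 (ix r).2.
have P1 : P *m (G *m P^T) = 1%:M.
  apply/matrixP => r r'; rewrite mulmxA mxE.
  have -> : \sum_j (P *m G) r j * P^T j r' =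
      (v (ix r).1 (ix r).2 *m G *m (v (ix r').1 (ix r').2)^T) 0 0.
    rewrite [RHS]mxE; apply: eq_bigr => k _; rewrite !mxE; congr (_ * _).
    by apply: eq_bigr => l _; rewrite !mxE.
  rewrite v_orthonormal -xpair_eqE -!surjective_pairing mxE; congr (_%:R).
  by rewrite (inj_eq enum_val_inj) (inj_eq (@cast_ord_inj _ _ _)).
by have /mulmx1_unit[_] := P1; rewrite unitmx_mul => /andP[].
Qed.

Definition contract_op (i : 'I_2) (j : 'I_m) : 'End(ext) :=
  linfun (contract (v i j *m G)).

Lemma E_opE i j al : E_op v i j al = wedge (one_form (v i j)) al.
Proof. exact: lfunE. Qed.

Lemma contract_opE i j al : contract_op i j al = contract (v i j *m G) al.
Proof. exact: lfunE. Qed.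

Lemma E_op_anti i j i' j' :
  (E_op v i j \o E_op v i' j')%VF + (E_op v i' j' \o E_op v i j)%VF = 0.
Proof.
by apply/lfunP => al; rewrite add_lfunE !comp_lfunE !E_opE wedge_one_form_anti zero_lfunE.
Qed.

Lemma contract_op_anti i j i' j' :
  (contract_op i j \o contract_op i' j')%VF +
  (contract_op i' j' \o contract_op i j)%VF = 0.
Proof.
by apply/lfunP => al; rewrite add_lfunE !comp_lfunE !contract_opE contract_anti zero_lfunE.
Qed.

Lemma E_contract_op i j i' j' :
  (E_op v i j \o contract_op i' j')%VF + (contract_op i' j' \o E_op v i j)%VF =
  ((i == i') && (j == j'))%:R *: \1%VF.
Proof.
apply/lfunP => al; rewrite add_lfunE !comp_lfunE !E_opE !contract_opE.
rewrite wedge_contract scale_lfunE id_lfunE; congr (_ *: _).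
have -> : (v i j *m (v i' j' *m G)^T) 0 0 = (v i' j' *m G *m (v i j)^T) 0 0.
  have tr11 (M : 'M[R]_1) : M^T 0 0 = M 0 0 by rewrite mxE.
  by rewrite -tr11 trmx_mul trmxK.
by rewrite v_orthonormal rmorph_nat eq_sym [j' == j]eq_sym.
Qed.

Lemma is_adjoint_comp i j i' j' :
  is_adjoint G (E_op v i j \o E_op v i' j')%VF (contract_op i' j' \o contract_op i j)%VF.
Proof.
move=> al be; rewrite !comp_lfunE !E_opE !contract_opE.
by rewrite !herm_wedge_one_form.
Qed.

Lemma is_adjoint_sum (T : Type) (r : seq T) (F F' : T -> 'End(ext)) :
  (forall i, is_adjoint G (F i) (F' i)) ->
  is_adjoint G (\sum_(i <- r) F i) (\sum_(i <- r) F' i).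
Proof.
move=> FF' al be; rewrite !sum_lfunE herm_suml herm_sumr.
by apply: eq_bigr => i _; exact: FF'.
Qed.

(** Adjoints being unique for a nondegenerate product, the adjoints of [L_op] and [V_op] are the
    explicit products of contractions. *)
Lemma sKahler_opsE : sKahler_ops G v =
  [set f | (exists j k, j != k /\
              (f = \sum_(i < 2) (E_op v i j \o E_op v i k)%VF \/
               f = \sum_(i < 2) (contract_op i k \o contract_op i j)%VF)) \/
           (exists j, f = (E_op v ord0 j \o E_op v ord_max j)%VF \/
                      f = (contract_op ord_max j \o contract_op ord0 j)%VF)].
Proof.
have adjL j k : is_adjoint G (L_op v j k)
    (\sum_(i < 2) (contract_op i k \o contract_op i j)%VF).
  by apply: is_adjoint_sum => i; exact: is_adjoint_comp.
have adjV j : is_adjoint G (V_op v j) (contract_op ord_max j \o contract_op ord0 j)%VF.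
  exact: is_adjoint_comp.
rewrite eqEsubset; split=> f.
  case=> [[[j [k [jk ->]]]|[j ->]]|[g [[j [k [jk ->]]]|[j ->]] adj_f]].
  - by left; exists j, k; split=> //; left.
  - by right; exists j; left.
  - left; exists j, k; split=> //; right.
    exact: (is_adjoint_unique gram_unit adj_f).
  - by right; exists j; right; exact: (is_adjoint_unique gram_unit adj_f).
case=> [[j [k [jk [->|->]]]]|[j [->|->]]].
- by left; left; exists j, k.
- by right; exists (L_op v j k) => //; left; exists j, k.
- by left; right; exists j.
- by right; exists (V_op v j) => //; right; exists j.
Qed.

Lemma ext1_neq0 : ext1 R n != 0.
Proof.
apply/negP => /eqP/ffunP/(_ finset.set0); rewrite !ffunE eqxx => /eqP.
by rewrite oner_eq0.
Qed.

Let A : algType C := end_algType (dim_proper ext1_neq0).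

Let e (i : 'I_2) (j : 'I_m) : A := E_op v i j.
Let t (i : 'I_2) (j : 'I_m) : A := contract_op i j.

Let ee i j i' j' : e i j * e i' j' + e i' j' * e i j = 0.
Proof. exact: E_op_anti. Qed.
Let tt i j i' j' : t i j * t i' j' + t i' j' * t i j = 0.
Proof. exact: contract_op_anti. Qed.
Let et i j i' j' : e i j * t i' j' + t i' j' * e i j =
  ((i == i') && (j == j'))%:R.
Proof. by rewrite -[RHS](scaler_nat _ (1 : A)); exact: E_contract_op. Qed.

Lemma lie_uL_isomorphic : (2 < m)%N ->
  real_lie_isomorphic (@end_bracket R _) (@mx_bracket R _)
    (lie_uL G v) (@su R m m).
Proof.
move=> m3.
have gen := bilinear_ops_generated ee tt et m3.
have ra := raise_anti ee tt et; have la := lower_anti ee tt et.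
have rl := raise_lower_anti ee tt et.
have uLE : lie_uL G v = quad (raise e t) (lower e t) @` special_unitary (split_form R m).
  by rewrite -gen /lie_uL sKahler_opsE.
pose q : {linear 'M[C]_(m + m) -> A} := quad (raise e t) (lower e t).
rewrite uLE; apply: (@split_su_isomorphic R m A (fun x y => x * y - y * x) q).
  exact: quad_inj ra rl.
by move=> M N; exact: (quad_bracket ra la rl).
Qed.

(** * The volume form has top degree and is nonzero *)

Section OmegaTop.

Let Om (js : seq 'I_m) : ext :=
  \big[@wedge R n/@ext1 R n]_(j <- js)
    wedge (one_form (v ord0 j)) (one_form (v ord_max j)).

Let Om_cons j js : Om (j :: js) =
  wedge (one_form (v ord0 j)) (wedge (one_form (v ord_max j)) (Om js)).
Proof. by rewrite /Om big_cons wedge_one_form_assoc. Qed.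

Let Om_degree js (K : {set 'I_n}) : #|K| != (2 * size js)%N -> Om js K = 0.
Proof.
elim: js K => [|j js IH] K; first by rewrite /Om big_nil muln0 cards_eq0 ffunE => /negPf->.
rewrite Om_cons (_ : (2 * size (j :: js))%N = (2 * size js).+2); last by rewrite /= mulnS.
move=> Kd; apply: wedge_one_form_degree Kd => {}K.
by apply: wedge_one_form_degree => {}K; exact: IH.
Qed.

Let contract_ext1 w : contract w (@ext1 R n) = 0.
Proof.
rewrite /contract big1 // => y _; apply/ffunP => K; rewrite extZE !ffunE.
case: ifP => _; first by rewrite mulr0.
rewrite (_ : (_ == finset.set0) = false) ?mulr0 //.
by apply/eqP => /setP/(_ y); rewrite setU11 inE.
Qed.

Let contract_wedge i j i' j' al :
  contract (v i j *m G) (wedge (one_form (v i' j')) al) =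
  ((i' == i) && (j' == j))%:R *: al -
  wedge (one_form (v i' j')) (contract (v i j *m G) al).
Proof.
have /lfunP/(_ al) := E_contract_op i' j' i j.
rewrite add_lfunE !comp_lfunE !E_opE !contract_opE scale_lfunE id_lfunE => <-.
by rewrite addrAC subrr add0r.
Qed.

Let Om_contract i j js : j \notin js -> contract (v i j *m G) (Om js) = 0.
Proof.
elim: js => [|j' js IH]; first by rewrite /Om big_nil contract_ext1.
rewrite in_cons negb_or eq_sym => /andP[jj' /IH Omj].
by rewrite Om_cons !contract_wedge (negPf jj') !andbF Omj !scale0r !(linear0, sub0r, oppr0).
Qed.

(** Contracting with the two vectors dual to the covectors of index [j] strips the first factor off
    and leaves the product over the remaining indices. *)
Let Om_neq0 js : uniq js -> Om js != 0.
Proof.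
elim: js => [_|j js IH /= /andP[jjs /IH]]; first by rewrite /Om big_nil ext1_neq0.
apply: contraNneq => /(congr1 (contract (v ord_max j *m G) \o contract (v ord0 j *m G))).
rewrite /= !linear0 Om_cons contract_wedge !eqxx scale1r [contract (v ord0 j *m G) _]contract_wedge.
rewrite (_ : (ord_max == ord0 :> 'I_2) = false) // scale0r sub0r.
rewrite Om_contract // linear0 oppr0 linear0 subr0 contract_wedge !eqxx scale1r.
by rewrite Om_contract // linear0 subr0 => ->.
Qed.

Let OmegaE : Omega v = Om (index_enum 'I_m).
Proof. by []. Qed.

Let size_index : size (index_enum 'I_m) = m.
Proof.
rewrite -(card_uniqP (index_enum_uniq 'I_m)) -[RHS]card_ord.
by apply: eq_card => j; rewrite mem_index_enum.
Qed.

Lemma Omega_top (K : {set 'I_n}) : K != [set: 'I_n]%SET -> Omega v K = 0.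
Proof.
by move=> KT; rewrite OmegaE Om_degree // size_index card_full.
Qed.

Lemma Omega_full_neq0 : Omega v [set: 'I_n]%SET != 0.
Proof.
have : Omega v != 0 by rewrite OmegaE Om_neq0 ?index_enum_uniq.
apply: contraNneq => O0; apply/eqP/ffunP => K; rewrite ffunE.
by have [->|/Omega_top] := eqVneq K [set: 'I_n]%SET.
Qed.

End OmegaTop.

Lemma vol_form_pairing : exists2 c : C, c != 0 &
  forall al be, vol_form G (Omega v) al be = pairing al be * c.
Proof.
eexists; last by move=> al be; apply: vol_formE; exact: Omega_top.
rewrite mulf_neq0 ?conjC_eq0 ?Omega_full_neq0 //.
have := minor_full_neq0 gram_unit; apply: contra_neq.
by rewrite -(rmorph0 (real_complex R)) => /complexI.
Qed.

Lemma preserves_vol_form (phi : ext -> ext) :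
  preserves_form (vol_form G (Omega v)) phi <-> preserves_form (@pairing R n) phi.
Proof.
have [c c0 volE] := vol_form_pairing.
split=> h al be; have := h al be; rewrite ?volE.
  by rewrite -mulrDl => /eqP; rewrite mulf_eq0 (negPf c0) orbF => /eqP.
by rewrite -mulrDl => ->; rewrite mul0r.
Qed.

Lemma sKahler_ops_symmetric f : sKahler_ops G v f ->
  forall al be, pairing (f al) be = pairing al (f be).
Proof.
(* The number [n.-1 = 2 * s + 1] is odd, so both transfer constants have square [-1]. *)
have [k1 k2] : 'i ^+ n.-1 * 'i ^+ n.-1 = -1 :> C /\
    ('i ^+ n.-1)^* * ('i ^+ n.-1)^* = -1 :> C.
  by apply: kappa_sqr; rewrite mulnS add2n /= mul2n odd_double.
have EE i j i' j' al be :
    pairing ((E_op v i j \o E_op v i' j')%VF al) be =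
    pairing al ((E_op v i j \o E_op v i' j')%VF be).
  rewrite !comp_lfunE !E_opE; apply: (pairing_anticommuting k1).
  - by move=> x y; rewrite pairing_wedge_one_form.
  - by move=> x y; rewrite pairing_wedge_one_form.
  - by move=> x; rewrite wedge_one_form_anti.
have TT i j i' j' al be :
    pairing ((contract_op i j \o contract_op i' j')%VF al) be =
    pairing al ((contract_op i j \o contract_op i' j')%VF be).
  rewrite !comp_lfunE !contract_opE; apply: (pairing_anticommuting k2).
  - by move=> x y; rewrite pairing_contract.
  - by move=> x y; rewrite pairing_contract.
  - by move=> x; rewrite contract_anti.
rewrite sKahler_opsE => -[[j [k [_ [->|->]]]]|[j [->|->]]] al be; rewrite ?EE ?TT //.
  by rewrite !sum_lfunE pairing_suml pairing_sumr; apply: eq_bigr => i _; rewrite EE.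
by rewrite !sum_lfunE pairing_suml pairing_sumr; apply: eq_bigr => i _; rewrite TT.
Qed.

Lemma preserves_pairing_closed :
  real_lie_subalgebra (@end_bracket R _)
    [set phi : 'End(ext) | preserves_form (@pairing R n) phi].
Proof.
have opp x y : x + y = 0 -> x = - y :> C by move=> /eqP; rewrite addr_eq0 => /eqP.
have opp' x y : x + y = 0 -> y = - x :> C by rewrite addrC; exact: opp.
split=> /= [al be|f g hf hg al be|a f hf al be|f g hf hg al be].
- by rewrite !zero_lfunE pairing0l pairing0r addr0.
- by rewrite !add_lfunE pairingDl pairingDr addrACA hf hg addr0.
- by rewrite !scale_lfunE pairingZl pairingZr conjC_real -mulrDr hf mulr0.
- have sub x y z : pairing (x - y) z = pairing x z - pairing y z.
    by rewrite pairingDl -scaleN1r pairingZl mulN1r.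
  have sub' x y z : pairing z (x - y) = pairing z x - pairing z y.
    by rewrite pairingDr -scaleN1r pairingZr rmorphN1 mulN1r.
  rewrite /end_bracket !add_lfunE !opp_lfunE !comp_lfunE sub sub'.
  rewrite (opp _ _ (hf (g al) be)) (opp _ _ (hg (f al) be)).
  rewrite (opp' _ _ (hf al (g be))) (opp' _ _ (hg al (f be))).
  by ring.
Qed.

Lemma lie_uLE : lie_uL G v =
  [set phi | lieL_complex G v phi /\ preserves_form (@pairing R n) phi].
Proof.
have hL : real_lie_subalgebra (@end_bracket R _) (lieL_real G v).
  exact: real_lie_generated_closed.
have hU : real_lie_subalgebra (@end_bracket R _) (lie_uL G v).
  exact: real_lie_generated_closed.
have [L0 _ _ _] := hL; have [U0 UD _ _] := hU.
have uL_sub : lie_uL G v `<=`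
    [set phi | lieL_complex G v phi /\ preserves_form (@pairing R n) phi].
  apply: real_lie_generated_min.
    have [c0 cD cZ cbr] := complexification_closed hL.
    have [p0 pD pZ pbr] := preserves_pairing_closed.
    split=> [|x y [? ?] [? ?]|a x [? ?]|x y [? ?] [? ?]]; split.
    + exact: c0. + exact: p0. + exact: cD. + exact: pD.
    + exact: cZ. + exact: pZ. + exact: cbr. + exact: pbr.
  move=> _ [f Sf <-]; split.
    exists 0, f; split; [exact: L0|exact: real_lie_generated_sub|by rewrite add0r].
  move=> al be; rewrite !scale_lfunE pairingZl pairingZr conjCi.
  by rewrite (sKahler_ops_symmetric Sf) mulNr subrr.
(* A generator [f] is ['i] times the element [- ('i *: f)] of [lie_uL]. *)
have L_sub : lieL_real G v `<=` complexification (lie_uL G v).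
  apply: real_lie_generated_min; first exact: complexification_closed.
  move=> f Sf; exists 0, (- (('i : C) *: f)); split; [exact: U0| |].
    by apply: (real_lie_oppr hU); apply: real_lie_generated_sub; exists f.
  by rewrite add0r scalerN scalerA -expr2 sqrCi scaleN1r opprK.
rewrite eqEsubset; split=> // phi [[g [h [/L_sub Lg /L_sub Lh ->]]]].
have [[g1 [g2 [Ug1 Ug2 ->]]] [h1 [h2 [Uh1 Uh2 ->]]]] := (Lg, Lh).
(* Regrouping writes the operator as [x + 'i *: y] with [x] and [y] both in [lie_uL]. *)
have -> : g1 + ('i : C) *: g2 + ('i : C) *: (h1 + ('i : C) *: h2) =
          (g1 - h2) + ('i : C) *: (g2 + h1).
  rewrite scalerDr scalerA -expr2 sqrCi scaleN1r [in RHS]scalerDr.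
  by rewrite -!addrA; congr (_ + _); rewrite [RHS]addrC -!addrA.
set x := g1 - h2; set y := g2 + h1 => phi_pairing.
have Ux : lie_uL G v x by exact: (real_lie_subr hU).
have Uy : lie_uL G v y by exact: UD.
clearbody x y; have [_ /= px] := uL_sub _ Ux; have [_ /= py] := uL_sub _ Uy.
suff -> : y = 0 by rewrite scaler0 addr0.
apply/lfunP => al; rewrite zero_lfunE; apply: pairing_nondegenerate => be.
(* Once the contribution of [x] is removed, invariance under ['i *: y] and under [y] gives ['i *+ 2]
   times the pairing of [y al] with [be] equal to zero. *)
have := phi_pairing al be; rewrite !add_lfunE pairingDl pairingDr addrACA px add0r.
rewrite !scale_lfunE pairingZl pairingZr conjCi.
have -> : pairing al (y be) = - pairing (y al) be.
  by apply/eqP; rewrite -addr_eq0 addrC py.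
rewrite mulrNN -mulr2n -mulrnAl => /eqP; rewrite mulf_eq0 mulrn_eq0 /=.
by rewrite (negPf (neq0Ci _)) => /eqP.
Qed.

End AdaptedCoframe.

Unset Implicit Arguments.

Theorem theorem7p5 (R : realType) (s : nat) (hs : (2 <= s)%N)
    (X : smooth_manifold R (2 * s.+1)) (K : almost_sKahler X)
    (p : X) (c : chart R (2 * s.+1) X) (hc : atlas c) (hp : cdom c p)
    (v : coframe R s) (hv : adapted_coframe (metric K) (omega K) c p v) :
  let G := invmx (metric K c p) in
  lie_uL G v =
    [set phi : 'End(ext R (2 * s.+1)) |
       lieL_complex G v phi /\ preserves_form (vol_form G (Omega v)) phi] /\
  real_lie_isomorphic (@end_bracket R _) (@mx_bracket R _)
    (lie_uL G v) (@su R s.+1 s.+1).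
Proof.
move=> G; have [v_orthonormal _] := hv.
split; last exact: lie_uL_isomorphic.
(* The form attached to [Omega v] is a nonzero multiple of [pairing], so both are preserved by the
   same operators. *)
rewrite (lie_uLE v_orthonormal) eqEsubset.
by split=> phi [L_phi] /(preserves_vol_form v_orthonormal).
Qed.
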